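(* Let $n$ and $d$ be integers with $n\geq 2d+2$ and $d\geq 1$. Then the circulant graph $C_n(d+1,d+2,\ldots,\lfloor\frac{n}{2}\rfloor)$ is $S_2$ if and only if $n>3d$ or $n=2d+2$.
   Context: For an integer $n\geq 1$ and $S\subseteq\{1,2,\ldots,\lfloor n/2\rfloor\}$, the circulant graph $C_n(S)$ has vertex set $\{0,1,\ldots,n-1\}$ and edge set $\{\{i,j\} : |i-j|\in S \text{ or } n-|i-j|\in S\}$. One writes $C_n(a_1,\ldots,a_t)$ for $C_n(\{a_1,\ldots,a_t\})$. The independence complex $\mathrm{Ind}(G)$ of a finite simple graph $G$ is the simplicial complex whose faces are the independent sets of $G$ (including the empty set). A simplicial complex $\Delta$ satisfies Serre's condition $S_2$ (over a field $k$) if its Stanley-Reisner ring $R=k[\Delta]$ satisfies $\mathrm{depth}(R_p)\geq\min\{2,\dim R_p\}$ for all primes $p$. It is known that this holds if and only if $\mathrm{link}_\Delta(F)$ is connected for every face $F\in\Delta$ (including $F=\emptyset$) with $\dim\mathrm{link}_\Delta(F)\geq 1$, where $\mathrm{link}_\Delta(F)=\{H\in\Delta : H\cap F=\emptyset,\ H\cup F\in\Delta\}$; in particular it does not depend on $k$. A graph $G$ is called $S_2$ if $\mathrm{Ind}(G)$ satisfies $S_2$. *)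

(* Defs.v *)
From HB Require Import structures.
From mathcomp Require Import all_boot all_algebra.
From mathcomp Require Import generic_quotient ring_quotient.
From mathcomp Require Import boolp.
From mathcomp Require Import mpoly.
From mathcomp Require Import ring.

Set Implicit Arguments.
Unset Strict Implicit.
Unset Printing Implicit Defensive.

Import GRing.Theory.

Local Open Scope ring_scope.
Local Open Scope quotient_scope.

(* The localization of a commutative ring at a prime ideal p: fractions a/s   *)
(* with s \notin p, where a/s = b/t iff u(at) = u(bs) for some u \notin p     *)
(* (the ring is not assumed to be a domain).                                  *)
Module Localization.
Section Localization.

Variables (R : comNzRingType) (pI : prime_idealr R).
Local Notation p := (pI : pred R).

Definition frac := {x : R * R | x.2 \notin p}.

Implicit Types x y z : frac.

Notation num x := (val x).1.
Notation den x := (val x).2.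

Lemma denP x : den x \notin p.
Proof. exact: valP x. Qed.

Lemma one_notin : 1 \notin p.
Proof. by rewrite idealr1. Qed.

Lemma mul_notin s t : s \notin p -> t \notin p -> s * t \notin p.
Proof. by move=> sp tp; rewrite prime_idealrM negb_or sp. Qed.

Definition mk (a s : R) (sp : s \notin p) : frac := Sub (a, s) sp.

Definition equivf x y :=
  `[< exists2 u, u \notin p & u * (num x * den y) = u * (num y * den x) >].

Lemma equivfP x y :
  reflect (exists2 u, u \notin p & u * (num x * den y) = u * (num y * den x))
          (equivf x y).
Proof. exact: asboolP. Qed.

Lemma equivf_refl : reflexive equivf.
Proof. by move=> x; apply/equivfP; exists 1 => //; exact: one_notin. Qed.

Lemma equivf_sym : ssrbool.symmetric equivf.
Proof. by move=> x y; apply/equivfP/equivfP => -[u up e]; exists u. Qed.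

Lemma equivf_trans : transitive equivf.
Proof.
move=> y x z /equivfP[u up exy] /equivfP[v vp eyz]; apply/equivfP.
exists (u * v * den y); first by rewrite !mul_notin ?denP.
transitivity (v * den z * (u * (num x * den y))); first by ring.
rewrite exy.
transitivity (u * den x * (v * (num y * den z))); first by ring.
by rewrite eyz; ring.
Qed.

Canonical equivf_equiv := EquivRel equivf equivf_refl equivf_sym equivf_trans.

Definition type := {eq_quot equivf}.

HB.instance Definition _ : EqQuotient _ equivf type := EqQuotient.on type.
HB.instance Definition _ := Choice.on type.

Lemma pi_eqP x y :
  reflect (exists2 u, u \notin p & u * (num x * den y) = u * (num y * den x))
          (x == y %[mod type]).
Proof. by rewrite eqmodE; exact: equivfP. Qed.

Lemma pi_eq x y : num x * den y = num y * den x -> \pi_type x = \pi_type y.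
Proof.
by move=> e; apply/eqP/pi_eqP; exists 1; rewrite ?one_notin // e.
Qed.

Lemma repr_piP x :
  exists2 u, u \notin p & u * (num (repr (\pi_type x)) * den x) =
                          u * (num x * den (repr (\pi_type x))).
Proof. by apply/pi_eqP; rewrite reprK. Qed.

Definition addf x y : frac :=
  mk (num x * den y + num y * den x) (mul_notin (denP x) (denP y)).
Definition add := lift_op2 type addf.

Lemma pi_add : {morph \pi : x y / addf x y >-> add x y}.
Proof.
move=> x y; unlock add; apply/eqP/pi_eqP => /=.
have [u up] := repr_piP x; have [v vp] := repr_piP y.
move: (repr _) (repr _) => x' y' ey ex.
exists (u * v); first exact: mul_notin.
transitivity (v * den y * den y' * (u * (num x * den x')) +
              u * den x * den x' * (v * (num y * den y'))); first by ring.
by rewrite -ex -ey; ring.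
Qed.
Canonical pi_add_morph := PiMorph2 pi_add.

Definition oppf x : frac := mk (- num x) (denP x).
Definition opp := lift_op1 type oppf.

Lemma pi_opp : {morph \pi : x / oppf x >-> opp x}.
Proof.
move=> x; unlock opp; apply/eqP/pi_eqP => /=.
have [u up] := repr_piP x; move: (repr _) => x' ex.
by exists u => //; rewrite !mulNr !mulrN ex.
Qed.
Canonical pi_opp_morph := PiMorph1 pi_opp.

Definition mulf x y : frac := mk (num x * num y) (mul_notin (denP x) (denP y)).
Definition mul := lift_op2 type mulf.

Lemma pi_mul : {morph \pi : x y / mulf x y >-> mul x y}.
Proof.
move=> x y; unlock mul; apply/eqP/pi_eqP => /=.
have [u up] := repr_piP x; have [v vp] := repr_piP y.
move: (repr _) (repr _) => x' y' ey ex.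
exists (u * v); first exact: mul_notin.
transitivity (u * (num x * den x') * (v * (num y * den y'))); first by ring.
by rewrite -ex -ey; ring.
Qed.
Canonical pi_mul_morph := PiMorph2 pi_mul.

Definition tolocf (a : R) : frac := mk a one_notin.
Definition toloc := lift_embed type tolocf.
Canonical toloc_pi_morph := PiEmbed toloc.

Lemma addA : associative add.
Proof.
elim/quotW=> x; elim/quotW=> y; elim/quotW=> z; rewrite !piE.
by apply: pi_eq => /=; ring.
Qed.

Lemma addC : commutative add.
Proof.
by elim/quotW=> x; elim/quotW=> y; rewrite !piE; apply: pi_eq => /=; ring.
Qed.

Lemma add0_l : left_id (toloc 0) add.
Proof. by elim/quotW=> x; rewrite !piE; apply: pi_eq => /=; ring. Qed.

Lemma addN_l : left_inverse (toloc 0) opp add.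
Proof. by elim/quotW=> x; rewrite !piE; apply: pi_eq => /=; ring. Qed.

HB.instance Definition _ := GRing.isZmodule.Build type addA addC add0_l addN_l.

Lemma mulA : associative mul.
Proof.
elim/quotW=> x; elim/quotW=> y; elim/quotW=> z; rewrite !piE.
by apply: pi_eq => /=; ring.
Qed.

Lemma mulC : commutative mul.
Proof.
by elim/quotW=> x; elim/quotW=> y; rewrite !piE; apply: pi_eq => /=; ring.
Qed.

Lemma mul1_l : left_id (toloc 1) mul.
Proof. by elim/quotW=> x; rewrite !piE; apply: pi_eq => /=; ring. Qed.

Lemma mul_addl : left_distributive mul add.
Proof.
elim/quotW=> x; elim/quotW=> y; elim/quotW=> z; rewrite !piE.
by apply: pi_eq => /=; ring.
Qed.

Lemma nonzero1 : toloc 1 != toloc 0 :> type.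
Proof.
rewrite !piE; apply/negP => /equivfP[u up] /=.
by rewrite !mulr1 mulr0 => u0; move: up; rewrite u0 idealr0.
Qed.

HB.instance Definition _ :=
  GRing.Zmodule_isComNzRing.Build type mulA mulC mul1_l mul_addl nonzero1.

End Localization.
End Localization.
HB.export Localization.

Definition localization (R : comNzRingType) (p : prime_idealr R) :
  comNzRingType := Localization.type p.

(* dim_ge A m : the Krull dimension of A is at least m, i.e. there is a chain *)
(* P_0 < P_1 < ... < P_m of prime ideals of A (P_i is irrelevant for i > m).  *)
Definition dim_ge (A : comNzRingType) (m : nat) : Prop :=
  exists P : nat -> prime_idealr A, forall i, (i < m)%N ->
    {subset P i <= P i.+1} /\ ~ {subset P i.+1 <= P i}.

Definition in_ideal_gen (A : comNzRingType) (rs : seq A) (a : A) : Prop :=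
  exists c : nat -> A, a = \sum_(i < size rs) c i * rs`_i.

(* rs = (x_1, ..., x_m) is a regular sequence: each x_i is a nonzerodivisor   *)
(* on A/(x_1, ..., x_{i-1}), and A/(x_1, ..., x_m) is nonzero.                *)
Definition regular_sequence (A : comNzRingType) (rs : seq A) : Prop :=
  (forall i, (i < size rs)%N -> forall a,
     in_ideal_gen (take i rs) (rs`_i * a) -> in_ideal_gen (take i rs) a) /\
  ~ in_ideal_gen rs 1.

(* The depth of a local ring A is the supremum of the lengths of the regular  *)
(* sequences in its maximal ideal, which consists of the non-invertible       *)
(* elements; depth_ge A m says that it is at least m (initial segments of     *)
(* regular sequences are regular).                                            *)
Definition depth_ge (A : comNzRingType) (m : nat) : Prop :=
  exists rs : seq A,
    [/\ size rs = m,
        forall x, x \in rs -> ~ (exists y, x * y = 1)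
      & regular_sequence rs].

(* Serre's condition S_r, depth R_p >= min(r, dim R_p) for all primes p: the  *)
(* m <= min(r, dim R_p) are those with m <= r and dim_ge R_p m.               *)
Definition serre_condition (r : nat) (R : comNzRingType) : Prop :=
  forall (p : prime_idealr R) (m : nat),
    (m <= r)%N -> dim_ge (localization p) m -> depth_ge (localization p) m.

Record simplicial_complex (n : nat) := SimplicialComplex {
  faces : {set {set 'I_n}};
  face0 : set0 \in faces;
  face_subset : forall F G : {set 'I_n}, F \in faces -> G \subset F -> G \in faces
}.

Section StanleyReisner.

Variables (k : fieldType) (n : nat) (Delta : simplicial_complex n).

(* The ideal generated by the squarefree monomials of the nonfaces of Delta.  *)
Definition SR_ideal (f : {mpoly k[n]}) : bool :=
  `[< exists c : {set 'I_n} -> {mpoly k[n]},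
        f = \sum_(F : {set 'I_n} | F \notin faces Delta)
              c F * \prod_(i in F) 'X_i >].

Lemma SR_idealP f :
  reflect (exists c : {set 'I_n} -> {mpoly k[n]},
             f = \sum_(F : {set 'I_n} | F \notin faces Delta)
                   c F * \prod_(i in F) 'X_i)
          (f \in SR_ideal).
Proof. exact: asboolP. Qed.

Lemma SR_ideal_closed : idealr_closed SR_ideal.
Proof.
split.
- apply/SR_idealP; exists (fun=> 0).
  by rewrite big1 // => F _; rewrite mul0r.
- apply/SR_idealP => -[c /(congr1 (meval (fun=> 0)))].
  rewrite rmorph1 rmorph_sum big1 => [/eqP|F FD]; first by rewrite oner_eq0.
  have [E|/set0Pn[i iF]] := eqVneq F set0; first by rewrite E face0 in FD.
  by rewrite rmorphM rmorph_prod (bigD1 i) //= mevalXU mul0r mulr0.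
- move=> a f g /SR_idealP[c ->] /SR_idealP[e ->]; apply/SR_idealP.
  exists (fun F => a * c F + e F); rewrite mulr_sumr -big_split /=.
  by apply: eq_bigr => F _; rewrite mulrDl mulrA.
Qed.

HB.instance Definition _ := isIdealr.Build {mpoly k[n]} SR_ideal SR_ideal_closed.

Definition SR_ring : comNzRingType := {ideal_quot (SR_ideal : idealr {mpoly k[n]})}.

Definition satisfies_S2 : Prop := serre_condition 2 SR_ring.

End StanleyReisner.

Record simple_graph (n : nat) := SimpleGraph {
  adj : rel 'I_n;
  adj_sym : ssrbool.symmetric adj;
  adj_irrefl : irreflexive adj
}.

Section IndependenceComplex.

Variables (n : nat) (G : simple_graph n).

Definition independent (F : {set 'I_n}) : bool :=
  [forall i in F, forall j in F, ~~ adj G i j].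

Lemma independent0 : set0 \in [set F | independent F].
Proof. by rewrite inE; apply/forall_inP => i; rewrite inE. Qed.

Lemma independent_subset (F H : {set 'I_n}) :
  F \in [set F | independent F] -> H \subset F -> H \in [set F | independent F].
Proof.
rewrite !inE => /forall_inP indF /subsetP sHF.
apply/forall_inP => i /sHF /indF /forall_inP indi.
by apply/forall_inP => j /sHF; exact: indi.
Qed.

Definition independence_complex : simplicial_complex n :=
  SimplicialComplex independent0 independent_subset.

End IndependenceComplex.

Definition graph_S2 (k : fieldType) (n : nat) (G : simple_graph n) : Prop :=
  satisfies_S2 k (independence_complex G).

Section Circulant.

Variables (n : nat) (S : pred nat).

Definition dist (i j : nat) : nat := (maxn i j - minn i j)%N.

(* The clause i != j is redundant when S is included in {1, ..., n./2}.       *)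
Definition circulant_adj (i j : 'I_n) : bool :=
  (i != j) && ((dist i j \in S) || ((n - dist i j)%N \in S)).

Lemma circulant_adj_sym : ssrbool.symmetric circulant_adj.
Proof.
by move=> i j; rewrite /circulant_adj /dist eq_sym maxnC minnC.
Qed.

Lemma circulant_adj_irrefl : irreflexive circulant_adj.
Proof. by move=> i; rewrite /circulant_adj eqxx. Qed.

Definition circulant : simple_graph n :=
  SimpleGraph circulant_adj_sym circulant_adj_irrefl.

End Circulant.

(* Main.v *)
From HB Require Import structures.
Require Import Defs.
From mathcomp Require Import all_boot all_algebra.
From mathcomp Require Import generic_quotient ring_quotient.
From mathcomp Require Import boolp.
From mathcomp Require Import mpoly.
From mathcomp Require Import ring zify.

(* The faces are the vertex sets with pairwise circular distance at most d.  If
   n > 3d the facets are the arcs of d + 1 consecutive vertices; if n = 2d + 2 the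
   complex is the boundary of a cross-polytope; in both cases the complex is pure
   and its links of positive dimension are connected.  If 2d + 3 <= n <= 3d, the
   link of the face consisting of 0, ..., 3d - n and d is the disjoint union of
   the simplex on 3d - n + 1, ..., d - 1, of positive dimension, and the point 2d.

   Connected links imply S_2.  Let q be the preimage of a prime in k[x_1, ..., x_n]
   and F the face of all i with x_i outside q.  For a facet G containing F, write
   f_G for the image of f in k[x_G].  If a_G is nonzero and b_G is regular modulo
   a_G locally at q for all these G, then b f = a h yields f_G = a_G e_G, and the
   e_G glue as soon as they agree on intersections of facets: on the intersection
   of G and H cancel a if it does not vanish there; otherwise this intersection
   is F, and one follows a chain of facets provided by the connectedness of the
   link of F.  If the link of F has positive dimension, a and b are the first two
   elementary symmetric polynomials in the x_i, i outside F.  Otherwise one or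
   both elements are found among the elements of q in k[x_F] by pseudo-division,
   adding one variable at a time: a chain of primes of length two below q prevents
   q from being generated by one element up to denominators.

   Conversely, if the link of F has an isolated vertex and positive dimension, the
   maximal ideal of the localization at (x_i, i outside F) is a sum of nonzero
   ideals I + J with I J = 0, and such a local ring has depth at most one. *)

Set Implicit Arguments.
Unset Strict Implicit.
Unset Printing Implicit Defensive.

Import GRing.Theory.

Local Open Scope ring_scope.
Local Open Scope quotient_scope.

(** * Localizations of quotient rings *)

(** Bare predicates let chains of primes of a localization be pulled back to the polynomial ring.
    The last clause expresses primality and absorption at once. *)
Definition prime_pred (A : comNzRingType) (q : pred A) : Prop :=
  [/\ 0 \in q, 1 \notin q, forall f g, f \in q -> g \in q -> f + g \in q &
      forall f g, (f * g \in q) = (f \in q) || (g \in q)].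

Lemma in_ideal_gen1 (A : comNzRingType) (a x : A) :
  in_ideal_gen [:: a] x <-> exists c, x = c * a.
Proof.
split=> -[c ->]; first by exists (c 0); rewrite big_ord1.
by exists (fun=> c); rewrite big_ord1.
Qed.

Lemma in_ideal_gen2 (A : comNzRingType) (a b x : A) :
  in_ideal_gen [:: a; b] x <-> exists c d, x = c * a + d * b.
Proof.
split=> [[c ->]|[c [d ->]]].
  by exists (c 0), (c 1); rewrite big_ord_recl big_ord1.
by exists (fun i => if i == 0%N then c else d); rewrite big_ord_recl big_ord1.
Qed.

Lemma in_ideal_gen0 (A : comNzRingType) (x : A) :
  in_ideal_gen [::] x <-> x = 0.
Proof.
by split=> [[c ->]|->]; [rewrite big_ord0 | exists (fun=> 0); rewrite big_ord0].
Qed.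

Section LocalizedQuotient.

Variables (S : comNzRingType) (I : idealr S) (p : prime_idealr {ideal_quot I}).

Definition pullback : pred S := [pred f | \pi_{ideal_quot I} f \in p].

Definition locmap (f : S) : localization p :=
  Localization.toloc p (\pi_{ideal_quot I} f).

Lemma tolocD a b :
  Localization.toloc p (a + b) = Localization.toloc p a + Localization.toloc p b.
Proof.
rewrite -[RHS]/(Localization.add _ _) !piE.
by apply: Localization.pi_eq => /=; rewrite !mulr1.
Qed.

Lemma tolocM a b :
  Localization.toloc p (a * b) = Localization.toloc p a * Localization.toloc p b.
Proof.
rewrite -[RHS]/(Localization.mul _ _) !piE.
by apply: Localization.pi_eq => /=; rewrite !mulr1.
Qed.

Lemma locmap_zmod_morphism : zmod_morphism locmap.
Proof.
move=> f g; apply/eqP; rewrite eq_sym subr_eq; apply/eqP.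
by rewrite /locmap -tolocD -rmorphD subrK.
Qed.

Lemma locmap_monoid_morphism : monoid_morphism locmap.
Proof. by split=> [|f g]; rewrite /locmap ?rmorph1 ?rmorphM ?tolocM. Qed.

HB.instance Definition _ :=
  GRing.isZmodMorphism.Build S (localization p) locmap locmap_zmod_morphism.
HB.instance Definition _ :=
  GRing.isMonoidMorphism.Build S (localization p) locmap locmap_monoid_morphism.

Lemma quot_eq0 f : (\pi_{ideal_quot I} f == 0) = (f \in I).
Proof. by rewrite -(rmorph0 \pi_{ideal_quot I}) -Quotient.idealrBE subr0. Qed.

Lemma locmap_eq0 f :
  locmap f = 0 <-> exists2 u, u \notin pullback & u * f \in I.
Proof.
rewrite /locmap -[0]/(Localization.toloc p 0) !piE; split.
  move=> /eqP; rewrite eqmodE => /Localization.equivfP [u up /=].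
  rewrite !mulr1 rmorph0 mulr0 -[u]reprK -rmorphM => /eqP; rewrite quot_eq0 => e.
  by exists (repr u); rewrite // /pullback inE /= reprK.
move=> [u up e]; apply/eqP; rewrite eqmodE; apply/Localization.equivfP.
exists (\pi u) => //=.
by rewrite !mulr1 rmorph0 mulr0 -rmorphM; apply/eqP; rewrite quot_eq0.
Qed.

Lemma locmap_unit s : s \notin pullback -> exists y, locmap s * y = 1.
Proof.
move=> sq; exists (\pi_(Localization.type p) (@Localization.mk _ p 1 (\pi_{ideal_quot I} s) sq)).
rewrite /locmap -[RHS]/(Localization.toloc p 1) !piE.
by apply: Localization.pi_eq => /=; rewrite ?rmorph1 !mulr1 !mul1r.
Qed.

Lemma locmap_lreg s x y :
  s \notin pullback -> locmap s * x = locmap s * y -> x = y.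
Proof.
move=> /locmap_unit[t st] e.
by rewrite -[x]mul1r -[y]mul1r -st ![_ * t]mulrC -!mulrA e.
Qed.

Lemma locmap_frac x :
  exists a s, s \notin pullback /\ locmap s * x = locmap a.
Proof.
elim/quotW: x => -[[a s] /= sp].
exists (repr a), (repr s); rewrite /pullback inE /= reprK; split=> //.
rewrite /locmap !reprK !piE.
by apply: Localization.pi_eq => /=; rewrite !mulr1 mulrC mul1r.
Qed.

Lemma pullback1 : 1 \notin pullback.
Proof. by rewrite inE rmorph1 idealr1. Qed.

Lemma pullback0 : 0 \in pullback.
Proof. by rewrite inE rmorph0 idealr0. Qed.

Lemma pullbackM f g : (f * g \in pullback) = (f \in pullback) || (g \in pullback).
Proof. by rewrite !inE rmorphM prime_idealrM. Qed.

Lemma pullbackD f g : f \in pullback -> g \in pullback -> f + g \in pullback.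
Proof. by rewrite !inE rmorphD; apply: rpredD. Qed.

Lemma pullbackB f g : f \in pullback -> g \in pullback -> f - g \in pullback.
Proof. by rewrite !inE rmorphB; apply: rpredB. Qed.

Lemma pullback_ideal f : f \in I -> f \in pullback.
Proof. by rewrite -quot_eq0 inE => /eqP ->; rewrite idealr0. Qed.

Lemma pullback_prime : prime_pred pullback.
Proof.
by split; [exact: pullback0 | exact: pullback1 | exact: pullbackD | exact: pullbackM].
Qed.

Lemma locmap_nonunit a :
  a \in pullback -> ~ exists y, locmap a * y = 1.
Proof.
move=> aq [y]; have [b [s [sq e]]] := locmap_frac y.
move=> /(congr1 (fun z => locmap s * z)).
rewrite mulrCA e mulr1 -rmorphM => /eqP; rewrite -subr_eq0 -rmorphB.
move=> /eqP/locmap_eq0[u uq /pullback_ideal].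
rewrite pullbackM (negPf uq) /= => h; case/negP: sq.
rewrite -[s](subKr (a * b)); apply: pullbackB => //.
by rewrite pullbackM aq.
Qed.

Lemma depth_ge0 : depth_ge (localization p) 0.
Proof.
exists [::]; split=> //; split=> // -[c].
by rewrite big_ord0 => /eqP; rewrite oner_eq0.
Qed.

Lemma locmap_nzd a :
  (forall f, a * f \in I -> exists2 u, u \notin pullback & u * f \in I) ->
  forall x, locmap a * x = 0 -> x = 0.
Proof.
move=> ha x; have [f [s [sq e]]] := locmap_frac x.
move=> /(congr1 (fun z => locmap s * z)).
rewrite mulrCA e mulr0 -rmorphM => /locmap_eq0[u uq].
rewrite mulrCA => /ha[w wq]; rewrite mulrA => h.
apply: (locmap_lreg sq); rewrite e mulr0; apply/locmap_eq0.
by exists (w * u); rewrite // pullbackM negb_or wq.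
Qed.

Lemma depth_ge1 a : a \in pullback ->
  (forall f, a * f \in I -> exists2 u, u \notin pullback & u * f \in I) ->
  depth_ge (localization p) 1.
Proof.
move=> aq ha; exists [:: locmap a]; split=> //.
  by move=> x; rewrite inE => /eqP ->; exact: locmap_nonunit.
split=> [[|//] _ x /=|].
  by move=> /in_ideal_gen0 /(locmap_nzd ha) ->; exact/in_ideal_gen0.
move=> /in_ideal_gen1[c e]; apply: (locmap_nonunit aq).
by exists c; rewrite mulrC.
Qed.

(** With fractions cleared, regularity of the images of [a] and [b] is divisibility of polynomials
    up to factors outside the pullback. *)
Lemma depth_ge2 a b : a \in pullback -> b \in pullback ->
  (forall f, a * f \in I -> exists2 u, u \notin pullback & u * f \in I) ->
  (forall f h, b * f - a * h \in I ->
     exists u e, u \notin pullback /\ u * f - a * e \in I) ->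
  depth_ge (localization p) 2.
Proof.
move=> aq bq ha hb; exists [:: locmap a; locmap b]; split=> //.
  by move=> x; rewrite !inE => /orP[] /eqP ->; exact: locmap_nonunit.
split=> [[|[|//]] _ x /=|].
- by move=> /in_ideal_gen0 /(locmap_nzd ha) ->; exact/in_ideal_gen0.
- move=> /in_ideal_gen1[c e]; apply/in_ideal_gen1.
  have [f [s [sq ef]]] := locmap_frac x.
  have [h [t [tq eh]]] := locmap_frac c.
  have : locmap (b * (t * f) - a * (s * h)) = 0.
    rewrite rmorphB !rmorphM /= -ef -eh.
    transitivity (locmap s * locmap t * (locmap b * x - c * locmap a)).
      by ring.
    by rewrite e subrr mulr0.
  move=> /locmap_eq0[w wq].
  rewrite mulrBr [w * (b * _)]mulrCA [w * (a * _)]mulrCA.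
  move=> /hb[u [g [uq huI]]].
  have hloc : locmap (u * w * t) * locmap f = locmap a * locmap g.
    apply/eqP; rewrite -subr_eq0 -!rmorphM -rmorphB; apply/eqP/locmap_eq0.
    exists 1; first exact: pullback1.
    by rewrite mul1r -!mulrA.
  have nq : u * w * t * s \notin pullback by rewrite !pullbackM !negb_or uq wq tq.
  have [y ey] := locmap_unit nq.
  exists (y * locmap g); transitivity (y * (locmap a * locmap g)); last by ring.
  rewrite -hloc -ef -[LHS]mul1r -ey !rmorphM /=; ring.
- move=> /in_ideal_gen2[c [d e]].
  have [f [s [sq ef]]] := locmap_frac c.
  have [h [t [tq eh]]] := locmap_frac d.
  have := pullbackD (f := a * (t * f)) (g := b * (s * h)).
  rewrite !pullbackM aq bq => /(_ isT isT) hq.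
  apply: (locmap_nonunit hq).
  have nq : t * s \notin pullback by rewrite !pullbackM !negb_or tq.
  have [y ey] := locmap_unit nq.
  exists y; rewrite -ey rmorphD !rmorphM /= -ef -eh; congr (_ * _).
  transitivity (locmap t * locmap s * (c * locmap a + d * locmap b)); first by ring.
  by rewrite -e mulr1.
Qed.

Lemma prime_idealr_prime (P : prime_idealr (localization p)) :
  prime_pred [pred f | locmap f \in P].
Proof.
split; rewrite ?inE ?rmorph0 ?rmorph1 ?idealr0 ?idealr1 //.
  by move=> f g; rewrite !inE rmorphD; exact: rpredD.
by move=> f g; rewrite !inE rmorphM prime_idealrM.
Qed.

Lemma prime_idealr_lt (P Q : prime_idealr (localization p)) :
  {subset P <= Q} -> ~ {subset Q <= P} ->
  {subset [pred f | locmap f \in P] <= [pred f | locmap f \in Q]} /\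
  exists2 f, locmap f \in Q & locmap f \notin P.
Proof.
move=> sPQ nQP; split; first by move=> f; rewrite !inE; exact: sPQ.
apply: contrapT => h; apply: nQP => x xQ.
have [a [s [sq e]]] := locmap_frac x.
have [y ey] := locmap_unit sq.
rewrite -[x]mul1r -ey -mulrA mulrCA e idealMr //.
apply: contrapT => /negP aP; apply: h; exists a => //.
by rewrite -e idealMr.
Qed.

Lemma prime_idealr_sub (P : prime_idealr (localization p)) f :
  locmap f \in P -> f \in pullback.
Proof.
move=> fP; apply: contraT => /locmap_unit[y e].
by have := idealMr y fP; rewrite mulrC e idealr1.
Qed.

Lemma prime_idealr_ideal (P : prime_idealr (localization p)) f :
  f \in I -> locmap f \in P.
Proof.
move=> fI; rewrite (_ : locmap f = 0) ?idealr0 //; apply/locmap_eq0.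
by exists 1; rewrite ?mul1r ?pullback1.
Qed.

End LocalizedQuotient.

(** * Restriction of polynomials to a face *)

(* Locked, like [univ] below: unification diverges when it unfolds [mmap]. *)
HB.lock Definition restrict (k : fieldType) (n : nat) (G : {set 'I_n}) :
    {mpoly k[n]} -> {mpoly k[n]} :=
  mmap (@mpolyC n k) (fun i => if i \in G then 'X_i else 0).

Section Restriction.

Variables (k : fieldType) (n : nat).
Local Notation S := {mpoly k[n]}.
Implicit Types (f g : S) (G H : {set 'I_n}) (m : 'X_{1..n}).

Lemma mpoly_ring_ind (P : S -> Prop) :
  (forall c, P c%:MP) -> (forall i, P 'X_i) ->
  (forall f g, P f -> P g -> P (f + g)) ->
  (forall f g, P f -> P g -> P (f * g)) -> forall f, P f.
Proof.
move=> PC PX PD PM; apply: mpolyind => [|c m f _ _ Pf]; first exact: PC.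
apply: (PD) => //; rewrite -mul_mpolyC; apply: (PM) => //.
rewrite mpolyXE_id; apply: (big_ind P) => [||i _]; [exact: PC | exact: PM | ].
by elim: (m i) => [|a IH]; [exact: PC | rewrite exprS; apply: (PM)].
Qed.

(** Congruence of [sigma] to the identity modulo J passes from the variables to products, by [f g -
    sigma f sigma g = g (f - sigma f) + sigma f (g - sigma g)]. *)
Lemma sub_subst (J : S -> Prop) (sigma : {rmorphism S -> S}) :
  J 0 -> (forall f g, J f -> J g -> J (f + g)) ->
  (forall f g, J f -> J (g * f)) ->
  (forall c, sigma c%:MP = c%:MP) -> (forall i, J ('X_i - sigma 'X_i)) ->
  forall f, J (f - sigma f).
Proof.
move=> J0 JD JM sC JX; apply: mpoly_ring_ind => [c|//|f g|f g] => [|Jf Jg|Jf Jg].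
- by rewrite sC subrr.
- by rewrite rmorphD opprD addrACA; apply: JD.
- rewrite (_ : _ - _ = g * (f - sigma f) + sigma f * (g - sigma g)).
    by apply: JD; apply: (JM).
  by rewrite rmorphM; ring.
Qed.

Definition msub m : {set 'I_n} := [set i | m i != 0%N].

Lemma restrict_zmod_morphism G : zmod_morphism (@restrict k n G).
Proof. by rewrite unlock; exact: rmorphB. Qed.

Lemma restrict_monoid_morphism G : monoid_morphism (@restrict k n G).
Proof. by rewrite unlock; split; [exact: rmorph1 | exact: rmorphM]. Qed.

HB.instance Definition _ G := GRing.isZmodMorphism.Build S S
  (restrict G) (restrict_zmod_morphism G).
HB.instance Definition _ G := GRing.isMonoidMorphism.Build S S
  (restrict G) (restrict_monoid_morphism G).

Lemma restrictC G (c : k) : restrict G c%:MP = c%:MP :> S.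
Proof. by rewrite unlock; exact: mmapC. Qed.

Lemma restrictXU G i : restrict G ('X_i : S) = if i \in G then 'X_i else 0.
Proof. by rewrite unlock mmapX mmap1U. Qed.

Lemma restrictX G m : restrict G ('X_[m] : S) = if msub m \subset G then 'X_[m] else 0.
Proof.
rewrite unlock mmapX /mmap1; case: ifPn => [/subsetP mG|/subsetPn[i]].
  rewrite mpolyXE_id; apply: eq_bigr => i _.
  have [->|mi] := eqVneq (m i) 0%N; first by rewrite !expr0.
  by rewrite mG // inE.
rewrite inE => mi iG; rewrite (bigD1 i) //= (negPf iG).
by rewrite expr0n (negPf mi) mul0r.
Qed.

Lemma mcoeff_restrict G f m :
  (restrict G f)@_m = if msub m \subset G then f@_m else 0.
Proof.
elim/mpolyind: f m => [|c m' f _ _ IH] m; first by rewrite rmorph0 mcoeff0 if_same.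
rewrite rmorphD /= !mcoeffD IH -mul_mpolyC rmorphM /= restrictC restrictX.
rewrite !mul_mpolyC !mcoeffZ mcoeffX.
case: ifPn => [m'G|nm'G].
  rewrite mcoeffX; have [<-|_] := eqVneq m' m; first by rewrite m'G.
  by rewrite !mulr0 !add0r.
rewrite mcoeff0 mulr0 add0r; have [<-|_] := eqVneq m' m.
  by rewrite (negPf nm'G).
by rewrite mulr0 add0r.
Qed.

Lemma restrict_restrict G H f : restrict G (restrict H f) = restrict (G :&: H) f.
Proof.
apply/mpolyP => m; rewrite !mcoeff_restrict subsetI.
by case: (msub m \subset G).
Qed.

Lemma restrictTid f : restrict setT f = f.
Proof. by apply/mpolyP => m; rewrite mcoeff_restrict subsetT. Qed.

Lemma restrict_sub G H f : G \subset H -> restrict G f = f -> restrict H f = f.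
Proof. by move=> /setIidPr GH <-; rewrite restrict_restrict GH. Qed.

Lemma restrict_prod G H : 
  restrict G (\prod_(i in H) 'X_i : S) = if H \subset G then \prod_(i in H) 'X_i else 0.
Proof.
rewrite rmorph_prod /=; case: ifPn => [/subsetP HG|/subsetPn[i iH iG]].
  by apply: eq_bigr => i iH; rewrite restrictXU HG.
by rewrite (bigD1 i) //= restrictXU (negPf iG) mul0r.
Qed.

Variable Delta : simplicial_complex n.
Local Notation I := (SR_ideal (k := k) Delta).

(** The ideal is the intersection of the primes [(x_i, i outside G)]: restriction to the support of
    a monomial of f keeps its coefficient, so no such support is a face. *)
Lemma SR_idealE f :
  (f \in I) <-> (forall G, G \in faces Delta -> restrict G f = 0).
Proof.
split=> [/SR_idealP[c ->] G GD|h].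
  rewrite rmorph_sum big1 // => F FD /=; rewrite rmorphM /= restrict_prod.
  by case: ifPn => [/(face_subset GD)|_]; rewrite ?mulr0 // (negPf FD).
rewrite [f]mpolyE; rewrite big_seq; apply: rpred_sum => m; rewrite mcoeff_msupp => fm.
have mD : msub m \notin faces Delta.
  apply: contra fm => /h /(congr1 (mcoeff m)).
  by rewrite mcoeff_restrict subxx mcoeff0 => /eqP.
apply/SR_idealP.
(* Only the support of [m] gets a coefficient: the monomial divided by the product of its
   variables. *)
exists (fun F => if F == msub m
  then f@_m *: 'X_[(m - [multinom nat_of_bool (i \in F) | i < n])%MM] else 0).
rewrite (bigD1 (msub m)) //= eqxx [X in _ + X]big1 ?addr0; last first.
  by move=> F /andP[_ /negPf ->]; rewrite mul0r.
rewrite -scalerAl; congr (_ *: _).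
have -> : \prod_(i in msub m) 'X_i = 'X_[[multinom nat_of_bool (i \in msub m) | i < n]] :> S.
  rewrite mpolyXE_id big_mkcond; apply: eq_bigr => i _; rewrite mnmE.
  by case: (i \in _).
rewrite -mpolyXD submK //; apply/mnm_lepP => i; rewrite mnmE inE.
by case: (m i).
Qed.

End Restriction.

(** * Gluing over the facets *)

Section Gluing.

Variables (k : fieldType) (n : nat).
Local Notation S := {mpoly k[n]}.
Implicit Types (f g : S) (F G H T : {set 'I_n}) (m : 'X_{1..n}).

Definition stratum T f : S := \sum_(m <- msupp f | msub m == T) f@_m *: 'X_[m].

Lemma mcoeff_stratum T f m :
  (stratum T f)@_m = if msub m == T then f@_m else 0.
Proof.
rewrite /stratum raddf_sum /=.
have [mf|mf] := boolP (m \in msupp f); last first.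
  rewrite (memN_msupp_eq0 mf) if_same big_seq_cond big1 // => m' /andP[m'f _].
  rewrite mcoeffZ mcoeffX; have [e|_] := eqVneq m' m; last by rewrite mulr0.
  by rewrite e (negPf mf) in m'f.
rewrite big_mkcond (bigD1_seq m) ?msupp_uniq //= big1 ?addr0.
  by rewrite mcoeffZ mcoeffX eqxx mulr1.
move=> m' /negPf m'm; case: ifP => // _.
by rewrite mcoeffZ mcoeffX m'm mulr0.
Qed.

(** The stratum of support T is taken from any [e G] with T inside G; agreement on intersections
    makes the choice immaterial. *)
Lemma restrict_glue (Gs : {set {set 'I_n}}) (e : {set 'I_n} -> S) :
  (forall G H, G \in Gs -> H \in Gs ->
     restrict (G :&: H) (e G) = restrict (G :&: H) (e H)) ->
  exists g, forall G, G \in Gs -> restrict G g = restrict G (e G).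
Proof.
move=> he; pose gam T := if [pick G in Gs | T \subset G] is Some G then e G else 0.
exists (\sum_T stratum T (gam T)) => G GG; apply/mpolyP => m.
rewrite !mcoeff_restrict; case: ifPn => // mG.
rewrite raddf_sum /= (bigD1 (msub m)) //= big1 => [|T /negPf mT]; last first.
  by rewrite mcoeff_stratum eq_sym mT.
rewrite mcoeff_stratum eqxx addr0 /gam; case: pickP => [H /andP[HG mH]|/(_ G)].
  have /(congr1 (mcoeff m)) := he _ _ GG HG.
  by rewrite !mcoeff_restrict subsetI mG mH.
by rewrite GG mG.
Qed.

End Gluing.

Lemma sub_restrict_prime (k : fieldType) (n : nat) (q : pred {mpoly k[n]})
    (G : {set 'I_n}) f : prime_pred q -> (forall i, i \notin G -> 'X_i \in q) ->
  f - restrict G f \in q.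
Proof.
move=> [q0 _ qD qM] qX; apply: (@sub_subst k n (fun f => f \in q)) => //.
- by move=> ? ? h; rewrite qM h orbT.
- by move=> c; exact: restrictC.
move=> i; rewrite /= restrictXU; case: ifPn => [_|/qX iq].
  by rewrite subrr q0.
by rewrite subr0.
Qed.

(** In a pure complex whose facets have [D] vertices, the faces with [D] vertices are the facets. *)
Definition facets_over n (Delta : simplicial_complex n) (D : nat) (F : {set 'I_n}) :
    {set {set 'I_n}} :=
  [set G in faces Delta | (F \subset G) && (#|G| == D)].

(** * Primes over the Stanley-Reisner ideal, and regular pairs built facet by facet *)

Section PrimeOverSR.

Variables (k : fieldType) (n : nat) (Delta : simplicial_complex n).
Local Notation S := {mpoly k[n]}.
Local Notation I := (SR_ideal (k := k) Delta).
Variable p : prime_idealr (SR_ring k Delta).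
Local Notation q := (pullback (I := I) p).
Implicit Types (f g : S) (F G H T : {set 'I_n}) (m : 'X_{1..n}).

Definition unit_vars : {set 'I_n} := [set i | 'X_i \notin q].
Local Notation F := unit_vars.

Lemma pullback_prod (T : finType) (P : pred T) (x : T -> S) :
  (forall i, P i -> x i \notin q) -> \prod_(i | P i) x i \notin q.
Proof.
move=> h; apply: (big_ind (fun f => f \notin q)) => //; first exact: pullback1.
by move=> f g fq gq; rewrite pullbackM negb_or fq.
Qed.

Lemma pullback_sum (T : finType) (P : pred T) (x : T -> S) :
  (forall i, P i -> x i \in q) -> \sum_(i | P i) x i \in q.
Proof.
move=> h; apply: (big_ind (fun f => f \in q)) => //; first exact: pullback0.
by move=> f g; exact: pullbackD.
Qed.

Lemma unit_vars_prod : \prod_(i in F) 'X_i \notin q.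
Proof. by apply: pullback_prod => i; rewrite inE. Qed.

(** Otherwise the product of these variables would lie in the Stanley-Reisner ideal, hence in q. *)
Lemma unit_vars_face : F \in faces Delta.
Proof.
apply: contraT => FD; have := unit_vars_prod.
rewrite pullback_ideal //; apply/SR_idealE => G GD; rewrite restrict_prod.
by case: ifPn => // /(face_subset GD); rewrite (negPf FD).
Qed.

Lemma sub_restrict_pullback G f : F \subset G -> f - restrict G f \in q.
Proof.
move=> /subsetP FG; apply: sub_restrict_prime => [|i]; first exact: pullback_prime.
by apply: contraR => iq; apply: FG; rewrite inE.
Qed.

Lemma restrict_pullback G f : F \subset G -> (restrict G f \in q) = (f \in q).
Proof.
move=> /(sub_restrict_pullback f) h; apply/idP/idP => fq.
  by rewrite -[f](subrK (restrict G f)); exact: pullbackD.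
by rewrite -[restrict G f](subKr f); apply: pullbackB.
Qed.

Variable D : nat.
Hypothesis pureD : forall G, G \in faces Delta ->
  exists2 H, H \in faces Delta & G \subset H /\ #|H| = D.

Local Notation Gs := (facets_over Delta D F).

Lemma facets_overP G :
  G \in Gs -> [/\ G \in faces Delta, F \subset G & #|G| = D].
Proof. by rewrite inE => /and3P[? ? /eqP]. Qed.

(** The product over F vanishes on faces not containing F; by purity every other face lies in a
    facet over F. *)
Lemma restrict_facets_over f :
  (forall G, G \in Gs -> restrict G f = 0) -> \prod_(i in F) 'X_i * f \in I.
Proof.
move=> h; apply/SR_idealE => G GD; rewrite rmorphM /= restrict_prod.
case: ifPn => [FG|_]; last by rewrite mul0r.
have [H HD [GH cH]] := pureD GD.
have /h e : H \in Gs by rewrite inE HD cH eqxx (subset_trans FG GH).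
have := congr1 (restrict G) e.
by rewrite restrict_restrict (setIidPl GH) rmorph0 => ->; rewrite mulr0.
Qed.

Lemma nzd_of_facets a :
  (forall G, G \in Gs -> restrict G a != 0) ->
  forall f, a * f \in I -> exists2 u, u \notin q & u * f \in I.
Proof.
move=> ha f /SR_idealE h; exists (\prod_(i in F) 'X_i); first exact: unit_vars_prod.
apply: restrict_facets_over => G /[dup] GG /facets_overP[GD _ _].
by have /eqP := h G GD; rewrite rmorphM mulf_eq0 (negPf (ha G GG)) => /eqP.
Qed.

Lemma regular2_of_facets a b :
  (forall G, G \in Gs -> restrict G a != 0) ->
  (forall G f h, G \in Gs -> restrict G b * f = restrict G a * h ->
     exists u e, u \notin q /\ u * f = restrict G a * e) ->
  (forall G H, G \in Gs -> H \in Gs ->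
     restrict (G :&: H) a = 0 -> G :&: H = F) ->
  (forall G H, G \in Gs -> H \in Gs ->
     connect [rel G H | [&& G \in Gs, H \in Gs & restrict (G :&: H) a != 0]] G H) ->
  forall f h, b * f - a * h \in I -> exists u e, u \notin q /\ u * f - a * e \in I.
Proof.
move=> a0 hab aF conn f h /SR_idealE bf.
have /choice[ue hue] G : exists ue : S * S, G \in Gs ->
    ue.1 \notin q /\ ue.1 * restrict G f = restrict G a * ue.2.
  have [GG|] := boolP (G \in Gs); last by exists (0, 0).
  have [GD _ _] := facets_overP GG; have /eqP := bf G GD.
  rewrite rmorphB !rmorphM /= subr_eq0 => /eqP /(hab _ _ _ GG)[u [e [uq ee]]].
  by exists (u, e).
(* A common denominator makes the quotients on different facets comparable. *)
pose u := \prod_(G in Gs) (ue G).1.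
have uq : u \notin q by apply: pullback_prod => G /hue[].
have /choice[e he] G : exists e, G \in Gs ->
    restrict G (u * f) = restrict G a * restrict G e.
  have [GG|] := boolP (G \in Gs); last by exists 0.
  exists (\prod_(H in Gs | H != G) (ue H).1 * (ue G).2) => _.
  have : u * restrict G f =
      restrict G a * (\prod_(H in Gs | H != G) (ue H).1 * (ue G).2).
    by rewrite mulrCA -(hue G GG).2 /u (bigD1 G) //=; ring.
  by move=> /(congr1 (restrict G)); rewrite !rmorphM /= !restrict_restrict setIid.
(* Both sides are the restriction of [u * f] to the intersection. *)
have heq G H : G \in Gs -> H \in Gs ->
    restrict (G :&: H) a * restrict (G :&: H) (e G) =
    restrict (G :&: H) a * restrict (G :&: H) (e H).
  move=> GG HG; have eG := congr1 (restrict H) (he G GG).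
  have eH := congr1 (restrict G) (he H HG).
  move: eG eH; rewrite !rmorphM /= !restrict_restrict [H :&: G]setIC -!rmorphM.
  by move=> <- <-.
have hcan G H : G \in Gs -> H \in Gs -> restrict (G :&: H) a != 0 ->
    restrict (G :&: H) (e G) = restrict (G :&: H) (e H).
  by move=> GG HG aGH; apply: (mulfI aGH); exact: heq.
(* Along the chain, F lies in each intersection of consecutive facets, where [a] can be
   cancelled. *)
have hF G H : G \in Gs -> H \in Gs -> restrict F (e G) = restrict F (e H).
  move=> GG HG; have /connectP[s sp ->] := conn G H GG HG.
  elim: s G {GG HG H} sp => [|H s IH] G //= /andP[/and3P[GG HG aGH] /IH <-].
  have /(congr1 (restrict F)) := hcan G H GG HG aGH.
  rewrite !restrict_restrict (setIidPl _) // subsetI.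
  by have [_ -> _] := facets_overP GG; have [_ -> _] := facets_overP HG.
have [g hg] : exists g, forall G, G \in Gs -> restrict G g = restrict G (e G).
  apply: restrict_glue => G H GG HG.
  have [aGH|] := eqVneq (restrict (G :&: H) a) 0; last exact: hcan.
  by rewrite (aF G H) //; apply: hF.
exists (\prod_(i in F) 'X_i * u), (\prod_(i in F) 'X_i * g).
rewrite pullbackM negb_or unit_vars_prod uq; split=> //.
rewrite -mulrA [a * _]mulrCA -mulrBr; apply: restrict_facets_over => G GG.
by rewrite rmorphB /= he // rmorphM /= hg // subrr.
Qed.

End PrimeOverSR.

(** * Two generators from a chain of primes *)

(* f as a polynomial in X_j; its coefficients are taken in the full ring but do
   not involve X_j. *)
HB.lock Definition univ (k : fieldType) (n : nat) (j : 'I_n) :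
    {mpoly k[n]} -> {poly {mpoly k[n]}} :=
  mmap (polyC \o @mpolyC n k) (fun i => if i == j then 'X else ('X_i)%:P).

Section Univariate.

Variables (k : fieldType) (n : nat).
Local Notation S := {mpoly k[n]}.
Implicit Types (f g h : S) (G W : {set 'I_n}) (j : 'I_n) (r : {poly S}).

Lemma univ_zmod_morphism j : zmod_morphism (@univ k n j).
Proof. by rewrite unlock; exact: rmorphB. Qed.

Lemma univ_monoid_morphism j : monoid_morphism (@univ k n j).
Proof. by rewrite unlock; split; [exact: rmorph1 | exact: rmorphM]. Qed.

HB.instance Definition _ j := GRing.isZmodMorphism.Build S {poly S}
  (univ j) (univ_zmod_morphism j).
HB.instance Definition _ j := GRing.isMonoidMorphism.Build S {poly S}
  (univ j) (univ_monoid_morphism j).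

Lemma univC j (c : k) : univ j c%:MP = (c%:MP)%:P.
Proof. by rewrite unlock; exact: mmapC. Qed.

Lemma univXU j i : univ j ('X_i : S) = if i == j then 'X else ('X_i)%:P.
Proof. by rewrite unlock mmapX mmap1U. Qed.

Lemma horner_univ j f : (univ j f).['X_j] = f.
Proof.
elim/mpoly_ring_ind: f => [c|i|f g ef eg|f g ef eg].
- by rewrite univC hornerC.
- by rewrite univXU; case: eqP => [->|_]; rewrite ?hornerX ?hornerC.
- by rewrite (rmorphD (univ j)) [_.[_]]hornerD; congr (_ + _).
- by rewrite (rmorphM (univ j)) [_.[_]]hornerM; congr (_ * _).
Qed.

Lemma univ_eq0 j f : (univ j f == 0) = (f == 0).
Proof.
apply/eqP/eqP => [e|->]; last exact: rmorph0.
by rewrite -[f](horner_univ j) e horner0.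
Qed.

Lemma univ_restrict j W f :
  univ j (restrict (j |: W) f) = map_poly (restrict W) (univ j f).
Proof.
elim/mpoly_ring_ind: f => [c|i|f g ef eg|f g ef eg].
- by rewrite restrictC univC map_polyC /= restrictC.
- rewrite restrictXU univXU !inE; have [->|ij] := eqVneq i j.
    by rewrite univXU eqxx map_polyX.
  rewrite map_polyC /= restrictXU; case: ifP => _.
    by rewrite univXU (negPf ij).
  by rewrite rmorph0.
- by rewrite !rmorphD /= ef eg.
- by rewrite !rmorphM /= ef eg.
Qed.

Lemma univ_const j G f : j \notin G -> restrict G f = f -> univ j f = f%:P.
Proof.
move=> jG <-; elim/mpoly_ring_ind: f => [c|i|f g ef eg|f g ef eg].
- by rewrite restrictC univC.
- rewrite restrictXU; case: ifPn => [iG|_]; last by rewrite rmorph0.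
  by rewrite univXU; case: eqP iG jG => [-> ->|].
- by rewrite !rmorphD /= ef eg.
- by rewrite !rmorphM /= ef eg.
Qed.

Lemma map_restrict_univ j W f : restrict (j |: W) f = f ->
  map_poly (restrict W) (univ j f) = univ j f.
Proof. by move=> fW; rewrite -univ_restrict fW. Qed.

Lemma coef_univ_restrict j W f i : restrict (j |: W) f = f ->
  restrict W (univ j f)`_i = (univ j f)`_i.
Proof. by move=> fW; rewrite -[in RHS](map_restrict_univ fW) coef_map. Qed.

Section OverW.

Variables (j : 'I_n) (W : {set 'I_n}) (r : {poly S}).
Hypotheses (jW : j \notin W) (rW : forall i, restrict W r`_i = r`_i).

Lemma univ_horner : univ j r.['X_j] = r.
Proof.
rewrite horner_coef rmorph_sum -[RHS]coefK poly_def; apply: eq_bigr => i _ /=.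
by rewrite (rmorphM (univ j)) (rmorphXn (univ j)) /= univXU eqxx (univ_const jW (rW i)) mul_polyC.
Qed.

Lemma restrict_horner : restrict (j |: W) r.['X_j] = r.['X_j].
Proof.
rewrite horner_coef rmorph_sum; apply: eq_bigr => i _ /=.
rewrite (rmorphM (restrict _)) (rmorphXn (restrict _)) /= restrictXU setU11.
by rewrite (restrict_sub (subsetUr _ _) (rW i)).
Qed.

End OverW.

Lemma pseudo_div j W g h : j \notin W ->
  restrict (j |: W) g = g -> restrict (j |: W) h = h -> g != 0 ->
  exists N (e r : S), [/\ lead_coef (univ j g) ^+ N * h = e * g + r,
    restrict (j |: W) r = r & (size (univ j r) < size (univ j g))%N].
Proof.
move=> jW gW hW g0; have ug0 : univ j g != 0 by rewrite univ_eq0.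
set c := lead_coef _; have cW : restrict W c = c by exact: coef_univ_restrict.
(* Quotient and remainder may have coefficients outside k[x_W]; restricting all coefficients fixes
   [c], [g] and [h] and preserves the identity. *)
have := congr1 (map_poly (restrict W)) (Pdiv.WeakIdomain.divp_eq (univ j h) (univ j g)).
rewrite -/c [map_poly _ (_ *: _)]map_polyZ (rmorphXn (restrict W)).
rewrite (rmorphD (map_poly (restrict W))) (rmorphM (map_poly (restrict W))) /=.
rewrite (map_restrict_univ gW) (map_restrict_univ hW) cW.
set N := scalp _ _; set Q := map_poly _ _; set r := map_poly _ (_ %% _).
have rW i : restrict W r`_i = r`_i.
  by rewrite coef_map /= restrict_restrict setIid.
move=> /(congr1 (horner^~ 'X_j)); rewrite [LHS]hornerZ [RHS]hornerD hornerM !horner_univ => e.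
exists N, Q.['X_j], r.['X_j]; split=> //; first exact: restrict_horner.
rewrite (univ_horner jW rW); apply: leq_ltn_trans (size_poly _ _) _.
by rewrite ltn_modp.
Qed.

End Univariate.

Lemma ex_min_measure (T : Type) (P : T -> Prop) (mu : T -> nat) :
  (exists x, P x) -> exists2 x, P x & forall y, P y -> (mu x <= mu y)%N.
Proof.
move=> [x Px]; have exm : exists m, `[< exists2 y, P y & mu y = m >].
  by exists (mu x); apply/asboolP; exists x.
have [_ /asboolP[y Py <-] ymin] := ex_minnP exm.
by exists y => // z Pz; apply: ymin; apply/asboolP; exists z.
Qed.

(** * Elements of a prime up to denominators, one variable at a time *)

Section HeightTwo.

Variables (k : fieldType) (n : nat).
Local Notation S := {mpoly k[n]}.
Implicit Types (f g h : S) (W E : {set 'I_n}) (j : 'I_n).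
Variable q : pred S.
Hypothesis q_prime : prime_pred q.

(** [f] is free of X_j and [g] is monic in X_j up to a factor outside q, so [g], [f] is a regular
    sequence in k[x_E] locally at q. *)
Definition two_generators E : Prop := exists W j f g,
  [/\ j \notin W, j |: W \subset E, [/\ f \in q, f != 0 & restrict W f = f] &
   [/\ g \in q, restrict (j |: W) g = g & lead_coef (univ j g) \notin q]].

Definition no_generator W : Prop := forall f, f \in q -> restrict W f = f -> f = 0.

(* The elements of q over W are multiples of g up to powers of c; [univ j c = c%:P]
   says that c is free of X_j, so that division by g lowers the X_j-degree. *)
Definition one_generator W : Prop := exists j c g,
  [/\ c \notin q, restrict W c = c & univ j c = c%:P] /\
  [/\ g \in q, restrict W g = g, (1 < size (univ j g))%N &
    forall h, h \in q -> restrict W h = h -> exists N e, c ^+ N * h = e * g].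

Lemma prime_predX f N : f \notin q -> f ^+ N \notin q.
Proof.
have [_ q1 _ qM] := q_prime => fq.
by elim: N => [|N IH]; rewrite ?expr0 // exprS qM negb_or fq.
Qed.

Lemma prime_predN f : f \in q -> - f \in q.
Proof. by have [_ _ _ qM] := q_prime; rewrite -mulN1r qM orbC => ->. Qed.

(** If q is zero over W, a nonzero element of least X_j-degree divides all others by
    pseudo-division. If [g] generates over W, it still does unless some element of q has an
    X_j-coefficient outside q; cutting that element off there gives a second generator. *)
Lemma generators_step W j : j \notin W ->
  [\/ two_generators W, no_generator W | one_generator W] ->
  [\/ two_generators (j |: W), no_generator (j |: W) | one_generator (j |: W)].
Proof.
have [q0 q1 qD qM] := q_prime.
move=> jW [[W' [i [f [g [iW' sW' hf hg]]]]]|W0|[i [c [g [[cq cW ci] [gq gW gs hg]]]]]].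
- apply: Or31; exists W', i, f, g; split=> //.
  exact: subset_trans sW' (subsetUr _ _).
- have [|] := pselect (no_generator (j |: W)); first exact: Or32.
  move=> h0; apply: Or33.
  have [g [gq gW g0] gmin] : exists2 g, [/\ g \in q, restrict (j |: W) g = g & g != 0] &
      forall h, [/\ h \in q, restrict (j |: W) h = h & h != 0] ->
      (size (univ j g) <= size (univ j h))%N.
    apply: (@ex_min_measure _ _ (fun g => size (univ j g))).
    apply: contrapT => h1; apply: h0 => f fq fW; apply: contrapT => f0.
    by apply: h1; exists f; split=> //; apply/eqP.
  have cW : restrict W (lead_coef (univ j g)) = lead_coef (univ j g).
    exact: coef_univ_restrict.
  have cq : lead_coef (univ j g) \notin q.
    apply: contraNN g0 => /W0 /(_ cW) /eqP.
    by rewrite lead_coef_eq0 univ_eq0.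
  exists j, (lead_coef (univ j g)), g; split; split=> //.
  + exact: restrict_sub (subsetUr _ _) cW.
  + exact: univ_const jW cW.
  + rewrite ltnNge; apply: contra cq => /size1_polyC ej.
    have e : (univ j g)`_0 = g.
      by rewrite -[RHS](horner_univ j) [in RHS]ej hornerC.
    by rewrite ej lead_coefC e.
  move=> h hq hW; have [N [e [r [eqr rW rs]]]] := pseudo_div jW gW hW g0.
  exists N, e; rewrite eqr; have [->|r0] := eqVneq r 0; first by rewrite addr0.
  have rq : r \in q.
    rewrite -[r](addKr (e * g)) -eqr qD //; last by rewrite qM hq orbT.
    by rewrite prime_predN // qM gq orbT.
  have := gmin r; rewrite leqNgt rs => /(_ _)/negP hr.
  by exfalso; apply: hr.
have [hq|] := pselect (forall h, h \in q -> restrict (j |: W) h = h ->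
                         forall l, (univ j h)`_l \in q).
  apply: Or33; exists i, c, g; split; split=> //.
  - exact: restrict_sub (subsetUr _ _) cW.
  - exact: restrict_sub (subsetUr _ _) gW.
  move=> h hhq hW; rewrite -[h](horner_univ j) horner_coef.
  apply: (big_ind (fun x => exists N e, c ^+ N * x = e * g)).
  + by exists 0, 0; rewrite mulr0 mul0r.
  + move=> x y [N [e ex]] [M [e' ey]].
    exists (N + M)%N, (c ^+ M * e + c ^+ N * e').
    by rewrite exprD mulrDl -!mulrA -ex -ey; ring.
  move=> l _; have lW := coef_univ_restrict l hW.
  have [N [e ee]] := hg _ (hq _ hhq hW l) lW.
  by exists N, (e * 'X_j ^+ l); rewrite mulrA ee; ring.
move=> nh; apply: Or31.
have [h [hq hW [l hl]]] : exists h, [/\ h \in q, restrict (j |: W) h = h &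
    exists l, (univ j h)`_l \notin q].
  apply: contrapT => h1; apply: nh => h hq hW l; apply: contrapT => /negP hl.
  by apply: h1; exists h; split=> //; exists l.
have lmax l' : (univ j h)`_l' \notin q -> (l' <= size (univ j h))%N.
  by apply: contraR; rewrite -ltnNge => /ltnW/(nth_default 0) ->.
have [m hm mmax] := ex_maxnP (ex_intro (fun l => (univ j h)`_l \notin q) l hl) lmax.
(* The coefficients above [m] lie in q, so the truncation stays in q while its leading coefficient
   is outside q. *)
pose r := \poly_(l < m.+1) (univ j h)`_l.
have rW l' : restrict W r`_l' = r`_l'.
  by rewrite coef_poly; case: ifP => _; rewrite ?rmorph0 // coef_univ_restrict.
have rq : r.['X_j] \in q.
  rewrite -[r.[_]](subKr (univ j h).['X_j]) qD ?horner_univ // prime_predN //.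
  rewrite -{1}(horner_univ j h) -hornerN -hornerD horner_coef.
  apply: (big_ind (fun x => x \in q)) => // l' _; rewrite qM.
  rewrite coefB coef_poly; case: ltnP => [_|ml]; first by rewrite subrr q0.
  rewrite subr0; apply/orP; left; apply: contraLR ml => /mmax.
  by rewrite -ltnNge ltnS.
have g0 : g != 0 by apply: contraTneq gs => ->; rewrite rmorph0 size_poly0.
exists W, j, g, r.['X_j]; split=> //; split=> //; first exact: restrict_horner.
rewrite (univ_horner jW rW) lead_coef_poly //=.
by apply: contraNneq hm => ->.
Qed.

(** Induction on the size of E: over the empty set there are only constants, and a nonzero constant
    is not in q. *)
Lemma generators_trichotomy E :
  [\/ two_generators E, no_generator E | one_generator E].
Proof.
have [q0 q1 qD qM] := q_prime.
elim: {E}_.+1 {-2}E (ltnSn #|E|) => // m IH E.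
have [->|/set0Pn[j jE]] := eqVneq E set0 => cE.
  apply: Or32 => f fq f0; apply: contraNeq q1 => fn0.
  have e : f = (f@_0)%:MP.
    apply/mpolyP => u; rewrite -f0 mcoeff_restrict mcoeffC subset0.
    rewrite mcoeff_restrict subset0; have [->|u0] := eqVneq u 0%MM.
      by rewrite mulr1 (_ : msub _ = set0) ?eqxx //; apply/setP => i; rewrite !inE mnm0E.
    rewrite mulr0 ifN //; apply: contra u0 => /eqP/setP u0.
    by apply/eqP/mnmP => i; have := u0 i; rewrite !inE mnm0E => /negbFE/eqP.
  have c0 : f@_0 != 0 by rewrite -(mpolyC_eq0 n) -e.
  by rewrite -mpolyC1 -(mulVf c0) mpolyCM -e qM fq orbT.
rewrite -(setD1K jE); apply: generators_step; first by rewrite !inE eqxx.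
by apply: IH; move: cE; rewrite (cardsD1 j) jE.
Qed.

(** On k[x_E] the prime q1 lies strictly between 0 and q, so q is nonzero there; it remains to
    exclude a single generator [g]. *)
Lemma two_generators_chain (q1 : pred S) E : prime_pred q1 ->
  {subset q1 <= q} -> ~ {subset q <= q1} ->
  (forall f, f - restrict E f \in q1) ->
  (exists2 f, f \in q1 & restrict E f != 0) ->
  two_generators E.
Proof.
move=> [p0 p1 pD pM] sq1q nqq1 pE [f fp f0].
have [_ nq1 qD qM] := q_prime.
have rE h : (restrict E h \in q1) = (h \in q1).
  apply/idP/idP => hp; first by rewrite -[h](subrK (restrict E h)) pD.
  rewrite -[restrict E h](subKr h) pD // -mulN1r pM.
  by rewrite pE orbT.
case: (generators_trichotomy E) => // [E0|[j [c [g [[cq cE cj] [gq gE gs hg]]]]]].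
  exfalso; move/eqP: f0; apply; apply: E0; first by apply: sq1q; rewrite rE.
  by rewrite restrict_restrict setIid.
have [x xq xp] : exists2 x, x \in q & x \notin q1.
  apply: contrapT => h; apply: nqq1 => x xq; apply: contrapT => /negP xp.
  by apply: h; exists x.
have cp : c \notin q1 by apply: contra cq; exact: sq1q.
have cXp N : c ^+ N \notin q1.
  by elim: N => [|N IH]; rewrite ?expr0 // exprS pM negb_or cp.
have gp : g \notin q1.
  (* If [g] were in q1, every element of q would be, since [c] is outside q1. *)
  apply/negP => gp; have xEq : restrict E x \in q.
    rewrite -[restrict E x](subKr x) qD // prime_predN //.
    exact/sq1q/pE.
  have [|N [e ee]] := hg _ xEq; first by rewrite restrict_restrict setIid.
  have : c ^+ N * restrict E x \in q1 by rewrite ee pM gp orbT.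
  by rewrite pM rE (negPf xp) (negPf (cXp N)).
have c0 : c != 0 by apply: contraNneq cp => ->.
(* Descent on the X_j-degree: if [c ^+ N * h = e * g] with h in q1, then the restriction of [e] is a
   nonzero element of q1 of smaller degree. *)
exfalso; suff desc m h : h \in q1 -> restrict E h = h -> h != 0 ->
    ~~ (size (univ j h) < m)%N.
  have := desc _ (restrict E f) _ _ f0; rewrite rE restrict_restrict setIid.
  by move=> /(_ (size (univ j (restrict E f))).+1 fp erefl); rewrite ltnS leqnn.
elim: m h => [|m IH] h hp hE h0; first by rewrite ltn0.
have [N [e ee]] := hg h (sq1q _ hp) hE.
have ep : restrict E e \in q1.
  have : e * g \in q1 by rewrite -ee pM hp orbT.
  by rewrite rE pM (negPf gp) orbF.
have eeE : c ^+ N * h = restrict E e * g.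
  have := congr1 (restrict E) ee; rewrite !rmorphM rmorphXn /=.
  by rewrite cE hE gE.
have e0 : restrict E e != 0.
  apply: contra_neq h0 => e0; move/eqP: eeE; rewrite e0 mul0r mulf_eq0.
  by rewrite expf_eq0 (negPf c0) andbF => /eqP.
have := IH _ ep; rewrite restrict_restrict setIid => /(_ erefl e0).
apply: contra; have := congr1 (fun x => size (univ j x)) eeE.
rewrite !rmorphM rmorphXn /= cj -rmorphXn /= mul_polyC size_scale ?expf_neq0 //.
rewrite size_mul ?univ_eq0 //; last by apply: contraNneq gp => ->.
move=> ->; case: (size (univ j g)) gs => [|[|s]] // _.
by rewrite !addnS /= ltnS; apply: leq_ltn_trans; rewrite leq_addr.
Qed.

End HeightTwo.

(** * Connected links imply S_2 *)

Section RegularForms.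

Variables (k : fieldType) (n : nat).
Local Notation S := {mpoly k[n]}.
Implicit Types (f g h : S) (A G : {set 'I_n}).

Definition sum_vars A : S := \sum_(i in A) 'X_i.

Definition sum_pairs A : S :=
  \sum_(u : 'I_n * 'I_n | [&& u.1 \in A, u.2 \in A & (u.1 < u.2)%N]) 'X_u.1 * 'X_u.2.

Lemma sum_vars_neq0 A : A != set0 -> sum_vars A != 0.
Proof.
move=> /set0Pn[i iA]; apply/eqP => /(congr1 (mcoeff U_(i)%MM)).
rewrite /sum_vars raddf_sum (bigD1 i) //= big1 => [|j /andP[_ /negPf ji]].
  by rewrite mcoeffXU eqxx mcoeff0 addr0 => /eqP; rewrite oner_eq0.
by rewrite mcoeffXU ji.
Qed.

Lemma restrict_sum_vars G A : restrict G (sum_vars A) = sum_vars (A :&: G).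
Proof.
rewrite /sum_vars rmorph_sum /= big_mkcond [RHS]big_mkcond /=.
by apply: eq_bigr => i _; rewrite restrictXU inE; case: (i \in A).
Qed.

Lemma restrict_sum_pairs G A : restrict G (sum_pairs A) = sum_pairs (A :&: G).
Proof.
rewrite /sum_pairs rmorph_sum /= big_mkcond [RHS]big_mkcond /=.
apply: eq_bigr => -[i j] _ /=; rewrite !inE rmorphM /= !restrictXU.
by case: (i \in A); case: (j \in A); case: (i \in G); case: (j \in G);
  case: (i < j)%N; rewrite /= ?mul0r ?mulr0.
Qed.

(** As [sigma] kills L and is the identity modulo L, its kernel is (L); its image lies in a domain,
    so (L) is prime. *)
Lemma dvd_subst (sigma : {rmorphism S -> S}) (L f g h : S) :
  (forall c, sigma c%:MP = c%:MP) -> (forall i, exists e, 'X_i - sigma 'X_i = L * e) ->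
  sigma L = 0 -> sigma g != 0 -> g * f = L * h -> exists e, f = L * e.
Proof.
move=> sC sX sL sg e.
have [|||x ex] := @sub_subst k n (fun f => exists e, f = L * e) sigma _ _ _ sC sX f.
- by exists 0; rewrite mulr0.
- by move=> _ _ [x ->] [y ->]; exists (x + y); rewrite mulrDr.
- by move=> _ y [x ->]; exists (y * x); rewrite mulrCA.
exists x; rewrite -ex [sigma f](_ : _ = 0) ?subr0 //.
have /eqP := congr1 sigma e.
by rewrite !rmorphM sL mul0r mulf_eq0 (negPf sg) => /eqP.
Qed.

Lemma meval_sum_vars (P : 'I_n -> k) A : (sum_vars A).@[P] = \sum_(i in A) P i.
Proof. by rewrite /sum_vars rmorph_sum; apply: eq_bigr => i _; exact: mevalXU. Qed.

Lemma sum_vars_regular A v w : v \in A -> w \in A -> (v < w)%N ->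
  forall f h, sum_pairs A * f = sum_vars A * h -> exists e, f = sum_vars A * e.
Proof.
move=> vA wA vw f h; set L := sum_vars A.
have wv : w != v by apply: contraTneq vw => ->; rewrite ltnn.
(* ['X_v - L] is minus the sum of the other variables of A, so [sigma] eliminates X_v and kills
   L. *)
pose y i : S := if i == v then 'X_v - L else 'X_i.
pose sigma : {rmorphism S -> S} := mmap (@mpolyC n k) y.
have sX i : sigma 'X_i = y i by rewrite /sigma /= mmapX mmap1U.
have sC c : sigma c%:MP = c%:MP by rewrite /sigma /= mmapC.
have sJ i : exists e, 'X_i - sigma 'X_i = L * e.
  rewrite sX /y; case: eqP => [->|_]; last by exists 0; rewrite subrr mulr0.
  by exists 1; rewrite mulr1 subKr.
have sL : sigma L = 0.
  rewrite {1}/L /sum_vars rmorph_sum (bigD1 v) //= sX /y eqxx.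
  rewrite (eq_bigr (fun i => 'X_i)) => [|i /andP[_ /negPf iv]]; last by rewrite sX /y iv.
  by rewrite /L /sum_vars [in X in _ - X](bigD1 v) //= opprD addNKr addNr.
(* L divides [sum_pairs A - sigma (sum_pairs A)], but at the point with
   coordinates -1 at v and 1 at w, L vanishes and [sum_pairs A] does not. *)
apply: (dvd_subst sC sJ sL); apply/eqP => sP.
have [|||x] := @sub_subst k n (fun f => exists e, f = L * e) sigma _ _ _ sC sJ (sum_pairs A).
- by exists 0; rewrite mulr0.
- by move=> _ _ [x ->] [z ->]; exists (x + z); rewrite mulrDr.
- by move=> _ z [x ->]; exists (z * x); rewrite mulrCA.
pose P i : k := if i == v then -1 else if i == w then 1 else 0.
rewrite sP subr0 => /(congr1 (meval P)); rewrite mevalM meval_sum_vars.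
rewrite (bigD1 v) //= (bigD1 w) ?wA //= [X in _ + (_ + X)]big1; last first.
  by move=> i /andP[/andP[_ /negPf iv] /negPf iw]; rewrite /P iv iw.
rewrite addr0 /P eqxx (negPf wv) eqxx addNr mul0r /sum_pairs rmorph_sum /=.
rewrite (bigD1 (v, w)) /=; last by rewrite vA wA.
rewrite big1 => [|[i j] /= /andP[/and3P[iA jA ij]]].
  rewrite addr0 mevalM !mevalXU eqxx (negPf wv) eqxx mulr1 => /eqP.
  by rewrite oppr_eq0 oner_eq0.
rewrite xpair_eqE mevalM !mevalXU.
case: (eqVneq i v) ij => [->|iv] ij; last first.
  case: (eqVneq i w) ij => [->|_] ij _; last by rewrite mul0r.
  case: (eqVneq j v) ij => [->|jv] ij; first by rewrite ltnNge (ltnW vw) in ij.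
  case: (eqVneq j w) ij => [->|_] ij; last by rewrite mulr0.
  by rewrite ltnn in ij.
case: (eqVneq j v) ij => [->|jv] ij; first by rewrite ltnn in ij.
by case: (eqVneq j w) => [//|_] _; rewrite mulr0.
Qed.

End RegularForms.

(** * Depth at a prime, according to the size of F *)

Section SufficientS2.

Variables (k : fieldType) (n : nat) (Delta : simplicial_complex n) (D : nat).
Local Notation S := {mpoly k[n]}.
Local Notation I := (SR_ideal (k := k) Delta).
Implicit Types (f g h : S) (G H E T : {set 'I_n}).

Hypothesis pureD : forall G, G \in faces Delta ->
  exists2 H, H \in faces Delta & G \subset H /\ #|H| = D.

(** Connectedness of the link of F, of dimension [D - #|F| - 1 >= 1]: facets are adjacent when they
    share a vertex outside F. *)
Hypothesis connD : forall F, F \in faces Delta -> (#|F|.+1 < D)%N ->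
  forall G H, G \in facets_over Delta D F -> H \in facets_over Delta D F ->
  connect [rel G H | [&& G \in facets_over Delta D F, H \in facets_over Delta D F &
                         G :&: H != F]] G H.

Section AtPrime.

Variable p : prime_idealr (SR_ring k Delta).
Local Notation q := (pullback (I := I) p).
Local Notation F := (unit_vars p).
Local Notation Gs := (facets_over Delta D F).

Lemma card_face T : T \in faces Delta -> (#|T| <= D)%N.
Proof. by move=> /pureD[H _ [TH <-]]; exact: subset_leq_card. Qed.

Lemma notin_unit_vars i : (i \in ~: F) = ('X_i \in q).
Proof. by rewrite !inE negbK. Qed.

Lemma sum_vars_pullback : sum_vars k (~: F) \in q.
Proof. by apply: pullback_sum => i; rewrite notin_unit_vars. Qed.

Lemma sum_pairs_pullback : sum_pairs k (~: F) \in q.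
Proof.
apply: pullback_sum => -[i j] /= /and3P[].
by rewrite pullbackM notin_unit_vars => ->.
Qed.

Lemma facets_over_full G : #|F| = D -> G \in Gs -> G = F.
Proof.
by move=> cF /facets_overP[_ FG cG]; apply/esym/eqP; rewrite eqEcard FG cG cF leqnn.
Qed.

Lemma setD_facet_neq0 G : (#|F| < D)%N -> G \in Gs -> ~: F :&: G != set0.
Proof.
move=> FD /facets_overP[_ FG cG]; rewrite setIC -setDE -card_gt0.
by rewrite cardsD (setIidPr FG) cG subn_gt0.
Qed.

(** The product of the variables in F and T lies in q0, and the variables in F are outside q. *)
Lemma prime_nonface (q0 : pred S) T : prime_pred q0 -> {subset I <= q0} ->
  {subset q0 <= q} -> F :|: T \notin faces Delta ->
  exists2 i, i \in T & 'X_i \in q0.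
Proof.
move=> [z0 z1 zD zM] Iq0 q0q FT.
have : \prod_(i in F :|: T) 'X_i \in q0.
  apply/Iq0/SR_idealE => G GD; rewrite restrict_prod; case: ifPn => // /(face_subset GD).
  by rewrite (negPf FT).
apply: contraPP => h; apply/negP.
apply: (big_ind (fun f => f \notin q0)) => // [f g fq gq|i].
  by rewrite zM negb_or fq.
move=> iFT; apply/negP => iq0; apply: h; exists i => //.
move: iFT; rewrite in_setU => /orP[iF|//].
by have := q0q _ iq0; rewrite -notin_unit_vars in_setC iF.
Qed.

Lemma depth_linear : (#|F| < D)%N -> depth_ge (localization p) 1.
Proof.
move=> FD; apply: (depth_ge1 sum_vars_pullback); apply: (nzd_of_facets pureD) => G GG.
by rewrite restrict_sum_vars sum_vars_neq0 // setD_facet_neq0.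
Qed.

Lemma depth_quadratic : (#|F|.+1 < D)%N -> depth_ge (localization p) 2.
Proof.
move=> FD; apply: (depth_ge2 sum_vars_pullback sum_pairs_pullback).
  apply: (nzd_of_facets pureD) => G GG.
  by rewrite restrict_sum_vars sum_vars_neq0 // setD_facet_neq0 // ltnW.
have aF G H : G \in Gs -> H \in Gs ->
    restrict (G :&: H) (sum_vars k (~: F)) = 0 -> G :&: H = F.
  move=> /facets_overP[_ FG _] /facets_overP[_ FH _] /eqP.
  rewrite restrict_sum_vars; apply: contraTeq => GHF; apply: sum_vars_neq0.
  apply: contra GHF; rewrite setIC -setDE setD_eq0 => GHF.
  by rewrite eqEsubset GHF subsetI FG.
apply: (regular2_of_facets pureD) => //.
- by move=> G GG; rewrite restrict_sum_vars sum_vars_neq0 // setD_facet_neq0 // ltnW.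
- move=> G f h /facets_overP[_ FG cG].
  rewrite restrict_sum_vars restrict_sum_pairs => e.
  have : (1 < #|~: F :&: G|)%N.
    by rewrite setIC -setDE cardsD (setIidPr FG) cG ltn_subRL addn1.
  move=> /card_gt1P[v [w [vA wA vw]]].
  have [x ->] : exists x, f = sum_vars k (~: F :&: G) * x.
    have := vw; rewrite -val_eqE neq_ltn => /orP[vw'|wv'].
      exact: (sum_vars_regular vA wA vw' e).
    exact: (sum_vars_regular wA vA wv' e).
  by exists 1, x; rewrite mul1r; split=> //; exact: pullback1.
move=> G H GG HG; apply: connect_sub (connD (unit_vars_face p) FD GG HG) => G' H'.
move=> /and3P[GG' HG' GH']; apply: connect1; rewrite /= GG' HG' /=.
by apply: contra_neq GH'; exact: aF.
Qed.

Section Chain.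

Variables q0 q1 : pred S.
Hypotheses (q0_prime : prime_pred q0) (q1_prime : prime_pred q1).
Hypotheses (Iq0 : {subset I <= q0}) (q01 : {subset q0 <= q1}) (q1q : {subset q1 <= q}).
Hypothesis nq10 : exists2 f, f \in q1 & f \notin q0.

Let q0q : {subset q0 <= q}. Proof. by move=> f /q01/q1q. Qed.

Lemma full_vars : #|F| = D -> forall i, i \notin F -> 'X_i \in q0.
Proof.
move=> cF i iF; have [|j] := prime_nonface (T := [set i]) q0_prime Iq0 q0q.
  by apply/negP => /card_face; rewrite setUC cardsU1 iF cF ltnn.
by rewrite inE => /eqP ->.
Qed.

(** Modulo q0 every polynomial equals its restriction to E, so an element of q1 outside q0 survives
    restriction. *)
Lemma restrict_chain E : (forall i, i \notin E -> 'X_i \in q0) ->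
  exists2 f, f \in q1 & restrict E f != 0.
Proof.
move=> hE; have [f f1 f0] := nq10; exists f => //.
apply: contra f0 => /eqP e; rewrite -[f]subr0 -e.
exact: sub_restrict_prime.
Qed.

Lemma depth_full1 : #|F| = D -> depth_ge (localization p) 1.
Proof.
move=> cF; have [f f1 f0] := restrict_chain (full_vars cF).
apply: (depth_ge1 (q1q f1)); apply: (nzd_of_facets pureD) => G /(facets_over_full cF) ->.
exact: f0.
Qed.

Hypothesis nqq1 : exists2 f, f \in q & f \notin q1.

Lemma two_generators_pullback E : (forall i, i \notin E -> 'X_i \in q0) ->
  two_generators q E.
Proof.
move=> hE; apply: (@two_generators_chain _ _ q (pullback_prime p) q1) => //.
- by have [f fq /negP f1] := nqq1 => /(_ f fq).
- by move=> f; apply/q01; exact: sub_restrict_prime.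
- exact: restrict_chain.
Qed.

(** F is the only facet over F; pseudo-division by [g] in X_j shows that [g], [f] is a regular
    sequence. *)
Lemma depth_full2 : #|F| = D -> depth_ge (localization p) 2.
Proof.
move=> cF; have := two_generators_pullback (full_vars cF).
move=> [W [j [f [g [jW sW [fq f0 fW] [gq gW gc]]]]]].
have fF : restrict F f = f by apply: restrict_sub fW; exact: subset_trans (subsetUr _ _) sW.
have gF : restrict F g = g by exact: restrict_sub gW.
have g0 : g != 0.
  by apply: contraNneq gc => ->; rewrite rmorph0 lead_coef0 pullback0.
have GF := facets_over_full cF.
have a0 G : G \in Gs -> restrict G g != 0 by move=> /GF ->; rewrite gF.
apply: (depth_ge2 gq fq); first exact: (nzd_of_facets pureD).
apply: (regular2_of_facets pureD) => //.
- move=> G x y /GF ->; rewrite fF gF => e.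
  (* [x] may involve every variable, so the division is made over the whole complement of [j]. *)
  have jn : j \notin ~: [set j] by rewrite !inE eqxx.
  have [||N [z [r [er _ rs]]]] := @pseudo_div _ _ j (~: [set j]) g x jn _ _ g0.
  + by rewrite setUCr restrictTid.
  + by rewrite setUCr restrictTid.
  set c := lead_coef _ in gc er.
  (* f is free of X_j, so this forces r = 0 for degree reasons. *)
  have efr : f * r = g * (c ^+ N * y - f * z).
    transitivity (c ^+ N * (f * x) - g * f * z); last by rewrite e; ring.
    by rewrite mulrCA er; ring.
  exists (c ^+ N), z; split; first exact: (prime_predX (pullback_prime p)).
  rewrite er mulrC; suff -> : r = 0 by rewrite addr0.
  apply: contraTeq rs => r0; rewrite -leqNgt.
  have fr0 : f * r != 0 by rewrite mulf_neq0.
  have := congr1 (fun x => size (univ j x)) efr.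
  rewrite /= !rmorphM /= (univ_const jW fW) mul_polyC size_scale // => ->.
  rewrite size_mul ?univ_eq0 //; last first.
    by apply: contra_neq fr0 => e0; rewrite efr e0 mulr0.
  have : (0 < size (univ j (c ^+ N * y - f * z)))%N.
    rewrite size_poly_gt0 univ_eq0.
    by apply: contra_neq fr0 => e0; rewrite efr e0 mulr0.
  by case: (size (univ j (c ^+ N * y - f * z))) => // s _; rewrite addnS leq_addr.
- by move=> G H /GF -> /GF -> _; rewrite setIid.
- by move=> G H /GF -> /GF ->; exact: connect0.
Qed.

(** The link of F consists of points. A nonzero [a] in q over F vanishes on no intersection of
    facets, so all facets are linked; on each facet the sum of the variables outside F is a single
    variable, regular modulo [a]. *)
Lemma depth_corank1 : #|F|.+1 = D -> depth_ge (localization p) 2.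
Proof.
move=> cF; have [v vF hv] : exists2 v, v \notin F &
    forall i, i \notin v |: F -> 'X_i \in q0.
  have [H HD [FH cH]] := pureD (unit_vars_face p).
  have [v0 v0F] : exists v0, v0 \notin F.
    have : (F \proper H) by rewrite properEcard FH cH -cF leqnn.
    by move=> /properP[_ [v0 _ v0F]]; exists v0.
  have [[v vF vq]|h] := pselect (exists2 v, v \notin F & 'X_v \notin q0); last first.
    exists v0 => // i; rewrite !inE negb_or => /andP[_ iF].
    by apply: contrapT => /negP iq; apply: h; exists i; rewrite ?inE.
  exists v => // i; rewrite !inE negb_or => /andP[iv iF].
  (* F with both [i] and [v] has D + 1 vertices, so one of the two variables is in q0, and X_v is
     not. *)
  have [|j] := prime_nonface (T := [set i; v]) q0_prime Iq0 q0q.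
    apply/negP => /card_face; rewrite setUC -setUA cardsU1 cardsU1 vF.
    by rewrite in_setU1 (negPf iv) inE iF -cF add1n add1n ltnn.
  by rewrite !inE => /orP[/eqP ->|/eqP ->]; rewrite // (negPf vq).
have [a [aq aF a0]] : exists a, [/\ a \in q, restrict F a = a & a != 0].
  have := two_generators_pullback hv.
  move=> [W [j [f [g [jW sW [fq f0 fW] [gq gW gc]]]]]].
  have sWv i : i \in W -> i != v -> i \in F.
    move=> iW iv; have /subsetP/(_ i) := sW.
    by rewrite inE iW orbT inE in_set1 (negPf iv) => /(_ isT).
  have [vW|vW] := boolP (v \in W); last first.
    exists f; split=> //; apply: restrict_sub fW; apply/subsetP => i iW.
    by apply: sWv => //; apply: contraNneq vW => <-.
  have jF : j \in F.
    have /subsetP/(_ j (setU11 _ _)) := sW; rewrite inE in_set1 => /orP[/eqP jv|//].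
    by rewrite jv vW in jW.
  (* As [j] is in F, restriction to F commutes with taking X_j-coefficients; the leading one is
     outside q, so its restriction is nonzero. *)
  exists (restrict F g); rewrite restrict_pullback // restrict_restrict setIid.
  split=> //; apply: contra gc => /eqP e.
  rewrite -(restrict_pullback (G := F)) // lead_coefE -coef_map /= -univ_restrict.
  by rewrite (setUidPr _) ?sub1set // e rmorph0 coef0 pullback0.
have aG G : G \in Gs -> restrict G a = a.
  by move=> /facets_overP[_ FG _]; exact: restrict_sub aF.
have aGG G H : G \in Gs -> H \in Gs -> restrict (G :&: H) a = a.
  by move=> GG HG; rewrite -restrict_restrict !aG.
have aG0 G : G \in Gs -> restrict G a != 0 by move=> /aG ->.
apply: (depth_ge2 aq sum_vars_pullback); first exact: (nzd_of_facets pureD).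
apply: (regular2_of_facets pureD) => //.
- move=> G f h GG; rewrite aG // restrict_sum_vars => e.
  have [_ FG cG] := facets_overP GG.
  have [w ew] : exists w, ~: F :&: G = [set w].
    by apply/cards1P; rewrite setIC -setDE cardsD (setIidPr FG) cG -cF subSnn.
  have /setIP[wF wG] : w \in ~: F :&: G by rewrite ew inE.
  have eL : sum_vars k (~: F :&: G) = 'X_w by rewrite ew /sum_vars big_set1.
  rewrite eL in e.
  (* [a] is free of X_w, so X_w divides [h]. *)
  have [|||x ex] := @dvd_subst k n (restrict (~: [set w])) 'X_w h a f
      (restrictC _) _ _ _ (esym e).
  + move=> i; rewrite /= restrictXU !inE; case: eqP => [->|_].
      by exists 1; rewrite subr0 mulr1.
    by exists 0; rewrite subrr mulr0.
  + by rewrite /= restrictXU !inE eqxx.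
  + rewrite /= (restrict_sub _ aF) //; apply/subsetP => i iF.
    by rewrite !inE; apply: contraTneq iF => ->; rewrite -in_setC.
  exists 1, x; split; first exact: pullback1.
  have X0 : 'X_w != 0 :> S.
    by rewrite -eL sum_vars_neq0 // ew -card_gt0 cards1.
  by rewrite mul1r; apply: (mulfI X0); rewrite e ex mulrCA.
- by move=> G H GG HG /eqP; rewrite aGG // (negPf a0).
- by move=> G H GG HG; apply: connect1; rewrite /= GG HG aGG.
Qed.

End Chain.

End AtPrime.

Theorem S2_of_connected_links : satisfies_S2 k Delta.
Proof.
move=> p m m2 [P hP].
have FD := card_face (unit_vars_face p).
have chain i : (i < m)%N -> let q i := [pred f | locmap p f \in P i] in
    {subset q i <= q i.+1} /\ exists2 f, f \in q i.+1 & f \notin q i.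
  move=> im; have [sP nP] := hP i im.
  by have [sq [f fq fnq]] := prime_idealr_lt sP nP; split=> //; exists f.
have subq i : {subset [pred f | locmap p f \in P i] <= pullback p}.
  by move=> f; exact: prime_idealr_sub.
have Iq i : {subset I <= [pred f | locmap p f \in P i]}.
  by move=> f; exact: prime_idealr_ideal.
have pr i := prime_idealr_prime (P i).
case: m m2 hP chain => [|[|[|//]]] _ hP chain; first exact: depth_ge0.
  have [s01 n01] := chain 0 isT; move: FD; rewrite leq_eqVlt => /orP[/eqP FD|FD].
    exact: (depth_full1 (pr 0) (Iq 0) s01 (subq 1) n01 FD).
  exact: depth_linear.
have [s01 n01] := chain 0 isT; have [s12 n12] := chain 1 isT.
have nq1 : exists2 f, f \in pullback p & f \notin [pred f | locmap p f \in P 1].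
  by have [f fq fn] := n12; exists f => //; exact: subq fq.
move: FD; rewrite leq_eqVlt => /orP[/eqP FD|].
  exact: (depth_full2 (pr 0) (pr 1) (Iq 0) s01 (subq 1) n01 nq1 FD).
rewrite leq_eqVlt => /orP[/eqP FD|FD]; last exact: depth_quadratic.
exact: (depth_corank1 (pr 0) (pr 1) (Iq 0) s01 (subq 1) n01 nq1 FD).
Qed.

End SufficientS2.

(** * An isolated vertex of a link prevents S_2 *)

Section PrimeConstructions.

Variables (A : comNzRingType) (q : pred A) (q_prime : prime_pred q).

(** A copy of q that carries the proof [q_prime], so that the ideal structures can be attached to
    it. *)
Definition prime_ideal_of of prime_pred q : A -> bool := q.
Local Notation Q := (prime_ideal_of q_prime).

Lemma prime_ideal_of_closed : idealr_closed Q.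
Proof.
have [q0 q1 qD qM] := q_prime; split=> // a u v uq vq.
by apply: (qD (a * u) v); rewrite // qM [u \in q]uq orbT.
Qed.

Lemma prime_ideal_of_prime : prime_idealr_closed Q.
Proof. by have [_ _ _ qM] := q_prime => u v uv; rewrite -qM. Qed.

HB.instance Definition _ := isIdealr.Build A Q prime_ideal_of_closed.
HB.instance Definition _ := isPrimeIdealrClosed.Build A Q prime_ideal_of_prime.

Lemma prime_idealr_exists : exists P : prime_idealr A, P =i q.
Proof. by exists Q. Qed.

End PrimeConstructions.

Section LocalizedPrimes.

Variables (S : comNzRingType) (I : idealr S).

Lemma pullback_exists (r : pred S) : prime_pred r -> {subset I <= r} ->
  exists p : prime_idealr {ideal_quot I}, pullback p =i r.
Proof.
move=> [r0 r1 rD rM] Ir.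
have rN x : x \in r -> - x \in r by rewrite -mulN1r rM orbC => ->.
have reprE f : (repr (\pi_{ideal_quot I} f) \in r) = (f \in r).
  have h : repr (\pi_{ideal_quot I} f) - f \in r.
    by apply: Ir; rewrite Quotient.idealrBE reprK.
  apply/idP/idP => fr; last by rewrite -[repr _](subrK f) rD.
  by rewrite -[f](subKr (repr (\pi_{ideal_quot I} f))) rD // rN.
have pr : prime_pred [pred x : {ideal_quot I} | repr x \in r].
  split; rewrite ?inE.
  - by rewrite -(rmorph0 \pi_{ideal_quot I}) reprE.
  - by rewrite -(rmorph1 \pi_{ideal_quot I}) reprE.
  - move=> x y; rewrite !inE -[x]reprK -[y]reprK -rmorphD !reprE.
    exact: rD.
  - by move=> x y; rewrite !inE -[x]reprK -[y]reprK -rmorphM !reprE rM.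
have [p ep] := prime_idealr_exists pr.
by exists p => f; rewrite inE ep inE reprE.
Qed.

Variable p : prime_idealr {ideal_quot I}.
Local Notation q := (pullback p).

(** The extension of r consists of the fractions with numerator in r. As r lies in q it contains no
    denominator, so the choice of the fraction does not matter. *)
Lemma prime_idealr_locmap (r : pred S) : prime_pred r -> {subset I <= r} ->
  {subset r <= q} ->
  exists P : prime_idealr (localization p), forall f, (locmap p f \in P) = (f \in r).
Proof.
move=> [r0 r1 rD rM] Ir rq.
have nr f : f \notin q -> f \notin r by apply: contra; exact: rq.
pose Q x := exists a s, [/\ s \notin q, locmap p s * x = locmap p a & a \in r].
have QE x a s : s \notin q -> locmap p s * x = locmap p a -> Q x <-> a \in r.
  move=> sq e; split=> [[b [t [tq et br]]]|ar]; last by exists a, s.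
  have : locmap p (t * a - s * b) = 0.
    by rewrite rmorphB !rmorphM /= -e -et; ring.
  move=> /locmap_eq0[u uq /Ir].
  rewrite rM (negPf (nr u uq)) /= => h.
  have : t * a \in r by rewrite -[t * a](subrK (s * b)) rD // rM br orbT.
  by rewrite rM (negPf (nr t tq)).
have QL f : `[< Q (locmap p f) >] = (f \in r).
  apply/asboolP/idP; first by move/(QE _ f 1 (pullback1 p)); rewrite rmorph1 mul1r => ->.
  by move=> fr; apply/(QE _ f 1 (pullback1 p)) => //; rewrite rmorph1 mul1r.
have pr : prime_pred [pred x : localization p | `[< Q x >]].
  split; rewrite ?inE.
  - by rewrite -(rmorph0 (locmap p)) QL.
  - by rewrite -(rmorph1 (locmap p)) QL.
  - move=> x y; rewrite !inE => /asboolP[a [s [sq ea ar]]] /asboolP[b [t [tq eb br]]].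
    apply/asboolP; exists (t * a + s * b), (s * t); split.
    + by rewrite pullbackM negb_or sq.
    + by rewrite rmorphD !rmorphM /= -ea -eb; ring.
    + by rewrite rD // rM ?ar ?br orbT.
  - move=> x y; rewrite !inE.
    have [a [s [sq ea]]] := locmap_frac x; have [b [t [tq eb]]] := locmap_frac y.
    have stq : s * t \notin q by rewrite pullbackM negb_or sq.
    have eab : locmap p (s * t) * (x * y) = locmap p (a * b).
      by rewrite !rmorphM /= -ea -eb; ring.
    have -> : `[< Q x >] = (a \in r) by apply/asboolP/idP => /(QE x a s sq ea).
    have -> : `[< Q y >] = (b \in r) by apply/asboolP/idP => /(QE y b t tq eb).
    by rewrite -rM; apply/asboolP/idP => /(QE _ _ _ stq eab).
have [P eP] := prime_idealr_exists pr.
by exists P => f; rewrite eP inE QL.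
Qed.

Lemma prime_idealr_subset (P Q : prime_idealr (localization p)) :
  (forall f, locmap p f \in P -> locmap p f \in Q) -> {subset P <= Q}.
Proof.
move=> h x xP; have [a [s [sq e]]] := locmap_frac x.
have [y ey] := locmap_unit sq.
by rewrite -[x]mul1r -ey -mulrA mulrCA e idealMr // h // -e idealMr.
Qed.

(** The ring is local: if c = h/t with h in q, then t - h is outside q. *)
Lemma localization_unit_or (c : localization p) :
  (exists y, c * y = 1) \/ (exists y, (1 - c) * y = 1).
Proof.
have [h [t [tq e]]] := locmap_frac c.
have [hq|hq] := boolP (h \in q); [right|left].
  have thq : t - h \notin q.
    by apply: contra tq => th; rewrite -[t](subrK h) pullbackD.
  have [y ey] := locmap_unit thq; exists (locmap p t * y).
  by rewrite -[RHS]ey rmorphB /= -e; ring.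
have [y ey] := locmap_unit hq; exists (locmap p t * y).
by rewrite -[RHS]ey -e; ring.
Qed.

Lemma nonunit_frac (x : localization p) : ~ (exists y, x * y = 1) ->
  exists y f, x = y * locmap p f /\ f \in q.
Proof.
move=> nx; have [f [s [sq e]]] := locmap_frac x.
have [y ey] := locmap_unit sq; exists y, f; split.
  by rewrite -e mulrA [y * _]mulrC ey mul1r.
apply: contraT => fq; exfalso; apply: nx; have [z ez] := locmap_unit fq.
by exists (locmap p s * z); rewrite -[RHS]ez -e; ring.
Qed.

End LocalizedPrimes.

(** * Depth at most one from a splitting of the maximal ideal *)

Section NecessaryS2.

Variables (k : fieldType) (n : nat) (Delta : simplicial_complex n).
Local Notation S := {mpoly k[n]}.
Local Notation I := (SR_ideal (k := k) Delta).
Implicit Types (f g h : S) (G H F : {set 'I_n}).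

(** The prime generated by the variables outside [G], as the kernel of restriction. *)
Definition vanishing G : pred S := [pred f | restrict G f == 0].

Lemma vanishing_prime G : prime_pred (vanishing G).
Proof.
split; rewrite ?inE ?rmorph0 ?rmorph1 ?eqxx ?oner_eq0 //.
  by move=> f g; rewrite !inE rmorphD /= => /eqP -> /eqP ->; rewrite addr0.
by move=> f g; rewrite !inE rmorphM mulf_eq0.
Qed.

Lemma vanishing_ideal G : G \in faces Delta -> {subset I <= vanishing G}.
Proof. by move=> GD f /SR_idealE/(_ G GD) e; rewrite inE e. Qed.

Lemma vanishing_subset G H : H \subset G -> {subset vanishing G <= vanishing H}.
Proof.
move=> /setIidPl HG f; rewrite !inE => /eqP e.
by rewrite -HG -restrict_restrict e rmorph0.
Qed.

Lemma vanishing_var G i : ('X_i \in vanishing G) = (i \notin G).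
Proof.
rewrite inE restrictXU; case: ifP => _; last by rewrite eqxx.
apply/eqP => /(congr1 (mcoeff U_(i)%MM)); rewrite mcoeffXU eqxx mcoeff0 => /eqP.
by rewrite oner_eq0.
Qed.

Theorem not_S2_of_isolated_vertex F u1 u2 v :
  u1 \notin F -> u2 \notin F -> u1 != u2 -> v \notin F ->
  [set u1; u2] :|: F \in faces Delta -> v |: F \in faces Delta ->
  (forall w, w \notin v |: F -> w |: F \in faces Delta ->
     w |: (v |: F) \notin faces Delta) ->
  ~ satisfies_S2 k Delta.
Proof.
move=> u1F u2F u12 vF uD vD iso.
have u1D : u1 |: F \in faces Delta.
  by apply: face_subset uD _; rewrite setSU // subsetUl.
have u2D : u2 |: F \in faces Delta.
  by apply: face_subset uD _; rewrite setSU // subsetUr.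
have FD : F \in faces Delta by apply: face_subset vD _; rewrite subsetUr.
(* If [v] were [u1], it would have the neighbour [u2] in the link. *)
have vu1 : v != u1.
  apply: contraTneq uD => e; rewrite -setUA setUCA -e iso //.
    by rewrite !inE e eq_sym (negPf u12).
have [p ep] := pullback_exists (vanishing_prime F) (vanishing_ideal FD).
move=> /(_ p 2 isT) S2.
have chain G : G \in faces Delta -> F \subset G -> exists P : prime_idealr (localization p),
    forall f, (locmap p f \in P) = (f \in vanishing G).
  move=> GD FG; apply: prime_idealr_locmap (vanishing_prime G) (vanishing_ideal GD) _.
  by move=> f /(vanishing_subset FG); rewrite ep.
have [P0 e0] := chain _ uD (subsetUr _ _).
have [P1 e1] := chain _ u1D (subsetUr _ _).
have [P2 e2] := chain _ FD (subxx _).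
(* The chain of the primes of F with [u1] and [u2], of F with [u1], and of F. *)
have : dim_ge (localization p) 2.
  exists (fun i => if i is i.+1 then if i is _.+1 then P2 else P1 else P0).
  case=> [|[|//]] _; split.
  - apply: prime_idealr_subset => f; rewrite e0 e1; apply: vanishing_subset.
    by rewrite setSU // subsetUl.
  - move=> /(_ (locmap p 'X_u2)); rewrite e0 e1 !vanishing_var !inE eqxx orbT /=.
    by rewrite eq_sym (negPf u12) u2F => /(_ isT).
  - by apply: prime_idealr_subset => f; rewrite e1 e2; apply/vanishing_subset/subsetUr.
  - move=> /(_ (locmap p 'X_u1)); rewrite e1 e2 !vanishing_var !inE eqxx u1F.
    by move=> /(_ isT).
move=> /S2{S2}[[|a [|b [|? ?]]] [] //= _ nu [reg _]].
have locmap_neq0 i : i \notin F -> i |: F \in faces Delta -> locmap p 'X_i <> 0.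
  move=> iF iD /locmap_eq0[w wq /SR_idealE/(_ _ iD)/eqP].
  have Fi := subsetUr [set i] F.
  rewrite rmorphM mulf_eq0 => /orP[] h.
    by move: wq; rewrite ep; rewrite (vanishing_subset Fi).
  by have := vanishing_var (i |: F) i; rewrite inE h !inE eqxx.
(* [cI] vanishes on [v |: F]; the numerators in [cJ] are carried by [v |: F] and divisible by
   X_v. *)
pose cI (x : localization p) := exists y f, x = y * locmap p f /\
  restrict (v |: F) f = 0.
pose cJ (x : localization p) := exists y f, x = y * locmap p f /\
  (restrict (v |: F) f = f /\ restrict F f = 0).
have IJ x y : cI x -> cJ y -> x * y = 0.
  move=> [x' [f [-> f0]]] [y' [g [-> [gv gF]]]].
  rewrite mulrACA -rmorphM /= (_ : locmap p (f * g) = 0) ?mulr0 //.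
  apply/locmap_eq0; exists (\prod_(i in F) 'X_i).
    apply/negP; rewrite ep inE restrict_prod subxx.
    move=> /prodf_eq0[i iF /eqP Xi].
    by have := vanishing_var F i; rewrite inE Xi rmorph0 eqxx iF.
  apply/SR_idealE => G GD; rewrite !rmorphM /= restrict_prod.
  case: ifPn => [FG|_]; last by rewrite mul0r.
  (* A face containing F and [v] is [v |: F] because [v] is isolated, and [f] vanishes there; on
     faces without [v], [g] vanishes. *)
  have [vG|vG] := boolP (v \in G); last first.
    rewrite [restrict G g](_ : _ = 0) ?mulr0 // -gv restrict_restrict -gF.
    congr (restrict _ g); apply/setP => i; rewrite !inE.
    have [->|_] := eqVneq i v; first by rewrite (negPf vG) (negPf vF).
    by apply/andP/idP => [[]|iF] //; rewrite (subsetP FG).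
  suff -> : G = v |: F by rewrite f0 mul0r mulr0.
  apply/eqP; rewrite eqEsubset subUset sub1set vG FG !andbT.
  apply/subsetP => i iG; apply: contraT => ivF.
  have iFD : i |: F \in faces Delta.
    by apply: face_subset GD _; rewrite subUset sub1set iG FG.
  apply: contraTT (iso i ivF iFD) => _; rewrite negbK.
  by apply: face_subset GD _; rewrite !subUset !sub1set iG vG FG.
have dec x : ~ (exists y, x * y = 1) -> exists xI xJ, [/\ x = xI + xJ, cI xI & cJ xJ].
  move=> /nonunit_frac[y [f [-> ]]]; rewrite ep inE => /eqP f0.
  exists (y * locmap p (f - restrict (v |: F) f)), (y * locmap p (restrict (v |: F) f)).
  split.
  - by rewrite -mulrDr -rmorphD subrK.
  - exists y, (f - restrict (v |: F) f); split=> //.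
    by rewrite rmorphB /= restrict_restrict setIid subrr.
  - exists y, (restrict (v |: F) f); rewrite !restrict_restrict setIid.
    by rewrite (setIidPl _) ?subsetUr.
have [aI [aJ [ea aII aJJ]]] := dec a (nu a (mem_head _ _)).
have [bI [bJ [eb bII bJJ]]] := dec b (nu b (mem_last a [:: b])).
have areg x : a * x = 0 -> x = 0.
  by move=> ax; apply/in_ideal_gen0/(reg 0 isT x)/in_ideal_gen0.
(* b aI = bI aI = bI a, so aI is a multiple c a; now c or 1 - c is a unit. *)
have [c ec] : exists c, aI = c * a.
  apply/in_ideal_gen1/(reg 1 isT aI)/in_ideal_gen1; exists bI => /=.
  have h1 : bJ * aI = 0 by rewrite mulrC; apply: IJ.
  have h2 : bI * aJ = 0 by apply: IJ.
  by rewrite eb ea mulrDl mulrDr h1 h2.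
have [[y ey]|[y ey]] := localization_unit_or c.
  (* X_v lies in [cJ], so [c * a * X_v = aI * X_v = 0] with [c] invertible and [a] regular. *)
  apply: (locmap_neq0 v vF vD); apply: areg.
  have : aI * locmap p 'X_v = 0.
    apply: IJ => //; exists 1, 'X_v; rewrite mul1r; split=> //.
    by rewrite !restrictXU (negPf vF) setU11.
  rewrite ec => h; transitivity (y * (c * a * locmap p 'X_v)); last by rewrite h mulr0.
  by rewrite -[LHS]mul1r -ey; ring.
(* X_u1 lies in [cI] and kills [aJ]; by [(1 - c) * aI = c * aJ] it kills [aI] too, hence [a]. *)
apply: (locmap_neq0 u1 u1F u1D); apply: areg.
have hJ : aJ * locmap p 'X_u1 = 0.
  rewrite mulrC; apply: IJ => //; exists 1, 'X_u1; rewrite mul1r; split=> //.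
  by rewrite restrictXU !inE eq_sym (negPf vu1) (negPf u1F).
have hI : aI * locmap p 'X_u1 = 0.
  transitivity (y * ((1 - c) * aI * locmap p 'X_u1)).
    by rewrite -[LHS]mul1r -[in LHS]ey; ring.
  have -> : (1 - c) * aI = c * aJ.
    by apply/eqP; rewrite mulrBl mul1r subr_eq -mulrDr addrC -ea -ec.
  by rewrite -mulrA hJ !mulr0.
by rewrite ea mulrDl hI hJ addr0.
Qed.

End NecessaryS2.

(** * The independence complexes *)

Ltac if_lia :=
  repeat match goal with
  | |- context [if ?b then _ else _] =>
    lazymatch b with
    | context [if _ then _ else _] => fail
    | _ => let H := fresh "H" in destruct b eqn:H
    end
  end; simpl in *; lia.

Section CirculantComplex.

Variables n d : nat.
Hypotheses (d_gt0 : (0 < d)%N) (n_ge : (2 * d + 2 <= n)%N).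

Local Notation Delta :=
  (independence_complex (circulant n [pred a | (d + 1 <= a <= n./2)%N])).
Implicit Types (F G H T : {set 'I_n}) (x y a b c : 'I_n).

Definition close (x y : 'I_n) : bool := (dist x y <= d)%N || (n <= dist x y + d)%N.

(** The smaller of [dist] and [n - dist] is at most [n./2], and it is a connection length exactly
    when it exceeds d. *)
Lemma circulant_adjN x y :
  ~~ adj (circulant n [pred a | (d + 1 <= a <= n./2)%N]) x y = close x y.
Proof.
rewrite /= /circulant_adj /close !inE /dist -val_eqE /=.
have := ltn_ord x; have := ltn_ord y; move: (val x) (val y) => i j.
lia.
Qed.

Lemma faceP T :
  reflect (forall x y, x \in T -> y \in T -> close x y) (T \in faces Delta).
Proof.
rewrite inE; apply: (iffP forall_inP) => h x.
  by move=> y xT yT; rewrite -circulant_adjN; have /forall_inP := h x xT; apply.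
by move=> xT; apply/forall_inP => y yT; rewrite circulant_adjN h.
Qed.

Lemma close_sym x y : close x y = close y x.
Proof. by rewrite /close /dist maxnC minnC. Qed.

Lemma close_le x y : (x <= y)%N -> close x y = (y <= x + d)%N || (n + x <= y + d)%N.
Proof.
move=> xy; rewrite /close /dist (maxn_idPr xy) (minn_idPl xy).
by congr orb; lia.
Qed.

Lemma close_refl x : close x x.
Proof. by rewrite /close /dist; lia. Qed.

Lemma n_gt0 : (0 < n)%N. Proof. lia. Qed.

Definition shift (c : 'I_n) (t : nat) : 'I_n := Ordinal (ltn_pmod (c + t) n_gt0).

Lemma shiftE c t : (t < n)%N -> val (shift c t) = (if c + t < n then c + t else c + t - n)%N.
Proof.
move=> tn; rewrite /=; case: ltnP => h; first by rewrite modn_small.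
rewrite -[in LHS](subnK h) modnDr modn_small //.
by have := ltn_ord c; if_lia.
Qed.

(** The number of forward steps from [c] to [x], which turns circular distances into linear
    arithmetic. *)
Definition offset (c x : 'I_n) : nat := (if c <= x then x - c else x + n - c)%N.

Lemma offset_lt c x : (offset c x < n)%N.
Proof. by rewrite /offset; have := ltn_ord c; have := ltn_ord x; if_lia. Qed.

Lemma offsetK c x : shift c (offset c x) = x.
Proof.
apply: val_inj; rewrite shiftE ?offset_lt // /offset.
by move: (ltn_ord c) (ltn_ord x) => /=; if_lia.
Qed.

Lemma offset_shift c t : (t < n)%N -> offset c (shift c t) = t.
Proof.
move=> tn; rewrite /offset shiftE //.
by have := ltn_ord c; if_lia.
Qed.

Lemma offset_shiftl c x t : (t < n)%N ->
  offset (shift c t) x =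
    if (t <= offset c x)%N then (offset c x - t)%N else (offset c x + n - t)%N.
Proof.
move=> tn; rewrite /offset shiftE //.
by have := ltn_ord c; have := ltn_ord x; if_lia.
Qed.

Lemma offset_base b c x : offset c x =
  if (offset b c <= offset b x)%N then (offset b x - offset b c)%N
  else (offset b x + n - offset b c)%N.
Proof. by rewrite -offset_shiftl ?offset_lt // offsetK. Qed.

Lemma closeE c x y : close x y =
  (offset c x <= offset c y + d)%N && (offset c y <= offset c x + d)%N
  || (n <= offset c x + d - offset c y)%N || (n <= offset c y + d - offset c x)%N.
Proof.
rewrite /close /dist /offset.
by have := ltn_ord c; have := ltn_ord x; have := ltn_ord y; if_lia.
Qed.

Definition arc (c : 'I_n) : {set 'I_n} := [set x | (offset c x <= d)%N].

Lemma card_arc c : #|arc c| = d.+1.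
Proof.
have -> : arc c = [set shift c t | t : 'I_d.+1].
  apply/setP => x; rewrite inE; apply/idP/imsetP => [xc|[t _ ->]].
    by exists (Ordinal (xc : (offset c x < d.+1)%N)); rewrite //= offsetK.
  by have td := ltn_ord t; rewrite offset_shift; lia.
rewrite card_imset ?card_ord // => s t /(congr1 (offset c)).
have := ltn_ord s; have := ltn_ord t => sd td.
by rewrite !offset_shift => [/val_inj //||]; lia.
Qed.

Lemma arc_face c : arc c \in faces Delta.
Proof. by apply/faceP => x y; rewrite !inE (closeE c); lia. Qed.

(** * The case n > 3d: arcs of consecutive vertices *)

Section Arcs.

Hypothesis n_gt3d : (3 * d < n)%N.

Lemma face_arc T : T \in faces Delta -> exists c, T \subset arc c.
Proof.
move=> /faceP clT; have [->|/set0Pn[x0 x0T]] := eqVneq T set0.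
  by exists (Ordinal n_gt0); rewrite sub0set.
(* b lies d steps before x0: seen from b, T lies within 2d < n - d steps, so its
   element closest to b starts an arc containing T. *)
pose b := shift x0 (n - d).
have bx0 : offset b x0 = d.
  have e0 : offset x0 x0 = 0%N by rewrite /offset leqnn subnn.
  have tn : (n - d < n)%N by lia.
  by rewrite /b (offset_shiftl _ _ tn) e0; if_lia.
have small x : x \in T -> (offset b x <= 2 * d)%N.
  move=> xT; have := clT x x0 xT x0T; rewrite (closeE b) bx0.
  by have := offset_lt b x; lia.
have [c cT cmin] := arg_minnP (fun x => offset b x) x0T.
exists c; apply/subsetP => x xT; rewrite inE.
have := clT x c xT cT; have := cmin x xT; have := small x xT; have := small c cT.
rewrite (closeE b) (offset_base b c x).
by if_lia.
Qed.

Lemma arc_pure T : T \in faces Delta ->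
  exists2 H, H \in faces Delta & T \subset H /\ #|H| = d.+1.
Proof.
by move=> /face_arc[c Tc]; exists (arc c); rewrite ?arc_face // card_arc.
Qed.

Lemma facet_arc F G : G \in facets_over Delta d.+1 F -> exists c, G = arc c.
Proof.
rewrite inE => /and3P[/face_arc[c Gc] _ /eqP cG]; exists c.
by apply/eqP; rewrite eqEcard Gc card_arc cG leqnn.
Qed.

(** An arc slides one step at a time, and consecutive arcs share d vertices, more than F has. *)
Lemma arc_connected F : F \in faces Delta -> (#|F|.+1 < d.+1)%N ->
  forall G H, G \in facets_over Delta d.+1 F -> H \in facets_over Delta d.+1 F ->
  connect [rel G H | [&& G \in facets_over Delta d.+1 F,
    H \in facets_over Delta d.+1 F & G :&: H != F]] G H.
Proof.
move=> FD cF G H; set e := [rel G H | _].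
have e_sym : connect_sym e.
  by apply: sym_connect_sym => x y; rewrite /e /= setIC andbCA.
have facetE c : (arc c \in facets_over Delta d.+1 F) = (F \subset arc c).
  by rewrite inE arc_face card_arc eqxx andbT.
have walk a t : (t < n)%N -> (forall s, (s <= t)%N -> F \subset arc (shift a s)) ->
    connect e (arc a) (arc (shift a t)).
  have a0 : shift a 0 = a by apply: val_inj; rewrite /= addn0 modn_small.
  elim: t => [|t IH] tn hs; first by rewrite a0; exact: connect0.
  apply: connect_trans (IH (ltnW tn) _) _; first by move=> s st; apply: hs; exact: leqW.
  apply: connect1; rewrite /e /= !facetE !hs //=.
  set c := shift a t; set c' := shift a t.+1.
  have off x : offset c x = if (offset c' x < n.-1)%N then (offset c' x).+1 else 0%N.
    rewrite /c /c' !offset_shiftl //; last exact: ltnW.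
    by have := offset_lt a x; if_lia.
  (* [y] is the last vertex of [arc c']; the d others lie in [arc c]. *)
  set y := shift c d.+1; have cy : offset c y = d.+1 by rewrite offset_shift //; lia.
  have yc' : (offset c' y <= d)%N by move: cy; rewrite off; if_lia.
  apply/eqP => eF; have : (d <= #|F|)%N; last by rewrite leqNgt -ltnS cF.
  have := cardsD1 y (arc c'); rewrite card_arc inE yc' add1n => -[->].
  rewrite -eF; apply: subset_leq_card; apply/subsetP => x; rewrite !inE => /andP[xy xc'].
  rewrite xc' andbT leqNgt; apply: contra xy => dx; apply/eqP.
  by rewrite -(offsetK c x) /y; congr shift; move: dx; rewrite off; if_lia.
have to_shift a b : (forall s, (s <= offset a b)%N -> F \subset arc (shift a s)) ->
    connect e (arc a) (arc b).
  by move=> hs; have := walk a _ (offset_lt a b) hs; rewrite offsetK.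
move=> GG HG; have [a eG] := facet_arc GG; have [b eH] := facet_arc HG.
rewrite {}eG {}eH !facetE in GG HG *.
have [F0|/set0Pn[f0 f0F]] := eqVneq F set0.
  by apply: to_shift => s _; rewrite F0 sub0set.
(* The arc starting farther before [f0] slides forward; every arc on the way contains F. *)
have back a' b' : F \subset arc a' -> F \subset arc b' ->
    (offset b' f0 <= offset a' f0)%N -> connect e (arc a') (arc b').
  move=> /subsetP Fa /subsetP Fb ab; apply: to_shift => s sab.
  apply/subsetP => x xF; have := Fa x xF; have := Fb x xF.
  have := Fa f0 f0F; have := Fb f0 f0F; rewrite !inE.
  rewrite offset_shiftl; last exact: leq_ltn_trans sab (offset_lt _ _).
  move: ab sab; rewrite !(offset_base a' b').
  have := offset_lt a' b'; have := offset_lt a' f0; have := offset_lt a' x.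
  by if_lia.
have [ab|/ltnW ba] := leqP (offset b f0) (offset a f0); first exact: back.
by rewrite e_sym; apply: back.
Qed.

End Arcs.

(** * The case n = 2d + 2: the boundary of a cross-polytope *)

Section CrossPolytope.

Hypothesis n_eq : n = (2 * d + 2)%N.

Definition antipode (x : 'I_n) : 'I_n := shift x d.+1.

Lemma close_antipode x y : close x y = (y != antipode x).
Proof.
rewrite -val_eqE shiftE; last by lia.
rewrite /close /dist; have := ltn_ord x; have := ltn_ord y.
by if_lia.
Qed.

Lemma antipodeK : involutive antipode.
Proof.
move=> x; apply: val_inj; rewrite shiftE; last by lia.
rewrite shiftE; last by lia.
by have := ltn_ord x => /=; if_lia.
Qed.

(** A face contains no antipodal pair, so here T and its antipodal image partition the 2d + 2
    vertices. *)
Lemma cross_card T : T \in faces Delta ->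
  (forall x, (x \in T) || (antipode x \in T)) -> #|T| = d.+1.
Proof.
move=> /faceP clT fullT; have : ~: T = antipode @: T.
  apply/setP => x; rewrite inE; apply/idP/imsetP => [xT|[y yT ->]].
    by exists (antipode x); rewrite ?antipodeK //; have := fullT x; rewrite (negPf xT).
  by apply/negP => /(clT _ _ yT); rewrite close_antipode eqxx.
move=> e; have := cardsC T; rewrite e card_imset; last exact: can_inj antipodeK.
have half m : (m + m = n)%N -> m = d.+1 by lia.
by rewrite card_ord => /half.
Qed.

(** A maximal face meets every antipodal pair, since a vertex of a missed pair could be added. *)
Lemma cross_pure T : T \in faces Delta ->
  exists2 H, H \in faces Delta & T \subset H /\ #|H| = d.+1.
Proof.
move=> TD; have [H /maxsetP[/= HD Hmax] TH] := maxset_exists (P := fun H => H \in faces Delta) TD.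
exists H => //; split=> //; apply: cross_card => // x.
apply: contraT; rewrite negb_or => /andP[xH axH].
have xHD : x |: H \in faces Delta.
  have /faceP clH := HD; apply/faceP => y z; rewrite !inE.
  have clx w : w \in H -> close x w.
    by move=> wH; rewrite close_antipode; apply: contraNneq axH => <-.
  move=> /orP[/eqP ->|yH] /orP[/eqP ->|zH]; first exact: close_refl.
  - exact: clx.
  - by rewrite close_sym; exact: clx.
  - exact: clH.
by case/negP: xH; rewrite -(Hmax _ xHD (subsetUr _ _)) setU11.
Qed.

(** If G and H meet only in F, take v in G outside F and put it into H in place of its antipode: the
    new facet shares v with G and at least d vertices with H. *)
Lemma cross_connected F : F \in faces Delta -> (#|F|.+1 < d.+1)%N ->
  forall G H, G \in facets_over Delta d.+1 F -> H \in facets_over Delta d.+1 F ->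
  connect [rel G H | [&& G \in facets_over Delta d.+1 F,
    H \in facets_over Delta d.+1 F & G :&: H != F]] G H.
Proof.
move=> FD cF G H GG HG; set e := [rel G H | _].
have [GHF|GHF] := eqVneq (G :&: H) F; last first.
  by apply: connect1; rewrite /e /= GG HG GHF.
have [GD FG /eqP cG] : [/\ G \in faces Delta, F \subset G & #|G| == d.+1].
  by move: GG; rewrite inE => /and3P[].
have [HD FH /eqP cH] : [/\ H \in faces Delta, F \subset H & #|H| == d.+1].
  by move: HG; rewrite inE => /and3P[].
have /properP[_ [v vG vF]] : F \proper G.
  by rewrite properEcard FG cG; exact: ltnW.
have vH : v \notin H by apply: contra vF => vH; rewrite -GHF inE vG.
have avF x : x \in F -> x != antipode v.
  move=> xF; rewrite -close_antipode; have /faceP := GD; apply=> //.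
  exact: (subsetP FG).
pose G' := v |: (H :\ antipode v).
have cH1 : (d <= #|H :\ antipode v|)%N.
  by rewrite -ltnS -cH (cardsD1 (antipode v) H) -add1n leq_add2r leq_b1.
have FG' : F \subset G'.
  by apply/subsetP => x xF; rewrite !inE avF // (subsetP FH) // orbT.
have G'D : G' \in faces Delta.
  have /faceP clH := HD; apply/faceP => y z; rewrite !inE.
  move=> /orP[/eqP ->|/andP[yv yH]] /orP[/eqP ->|/andP[zv zH]].
  - exact: close_refl.
  - by rewrite close_antipode.
  - by rewrite close_sym close_antipode.
  - exact: clH.
have cG' : #|G'| = d.+1.
  apply/eqP; rewrite eqn_leq; apply/andP; split; last first.
    by rewrite /G' cardsU1 !inE (negPf vH) andbF.
  have [H' HD' [G'H' <-]] := cross_pure G'D.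
  exact: subset_leq_card.
have GG' : G' \in facets_over Delta d.+1 F by rewrite inE G'D FG' cG' eqxx.
apply: (connect_trans (y := G')); apply: connect1; rewrite /e /= GG' ?GG ?HG /=.
  by apply: contraNneq vF => <-; rewrite !inE vG eqxx.
apply: contraTneq cF => eF; rewrite -leqNgt ltnS -eF.
apply: leq_trans cH1 _; apply: subset_leq_card; apply/subsetP => x.
by rewrite !inE => /andP[-> ->]; rewrite orbT.
Qed.

End CrossPolytope.

(** * The case 2d + 3 <= n <= 3d: a link with an isolated vertex *)

Section IsolatedVertex.

Hypotheses (n_ge3 : (2 * d + 3 <= n)%N) (n_le3d : (n <= 3 * d)%N).

Lemma isolated_vertex : exists F u1 u2 v,
  [/\ u1 \notin F, u2 \notin F, u1 != u2 & v \notin F] /\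
  [/\ [set u1; u2] :|: F \in faces Delta, v |: F \in faces Delta &
      forall w, w \notin v |: F -> w |: F \in faces Delta ->
        w |: (v |: F) \notin faces Delta].
Proof.
have lt0 : (d - 2 < n)%N by lia.
have lt1 : (d - 1 < n)%N by lia.
have lt2 : (2 * d < n)%N by lia.
have lt3 : (d < n)%N by lia.
pose F : {set 'I_n} := [set x : 'I_n | (x <= 3 * d - n)%N || (x == d :> nat)].
(* From n >= 2d + 3 follows 3d - n < d - 2, so d - 2 and d - 1 are outside F. *)
exists F, (Ordinal lt0), (Ordinal lt1), (Ordinal lt2); split; first split.
- by rewrite inE /=; lia.
- by rewrite inE /=; lia.
- by rewrite -val_eqE /=; lia.
- by rewrite inE /=; lia.
split.
- apply/faceP => x y; rewrite !inE -!val_eqE /= /close /dist; lia.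
- apply/faceP => x y; rewrite !inE -!val_eqE /= /close /dist; lia.
move=> w wF /faceP wD.
apply/negP => /faceP/(_ w (Ordinal lt2)).
rewrite !in_setU1 !eqxx orbT => /(_ isT isT).
have hw (x : 'I_n) : (x <= 3 * d - n)%N || (x == d :> nat) -> close w x.
  by move=> xF; apply: wD; rewrite in_setU1 ?eqxx // inE xF orbT.
have w0 : close (Ordinal n_gt0) w by rewrite close_sym; exact: hw.
have wd : close w (Ordinal lt3) by apply: hw; rewrite /= eqxx orbT.
move: wF; rewrite in_setU1 inE -val_eqE /= !negb_or => /and3P[w2 wr wd'].
(* [w] is within d of 0 on one side. If w <= d, closeness to 2d puts [w] in F. *)
have wn := ltn_ord w; have [lo|hi] := leqP n (w + d)%N; last first.
  move: w0; rewrite !close_le /=; lia.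
have [w2d|w2d] := leqP w (2 * d); last first.
  by move: wd; rewrite close_sym close_le /=; lia.
(* This vertex lies d + 1 steps ahead of [w] around the circle, and it is in F because w < 2d. *)
have lt4 : (w + d + 1 - n < n)%N by lia.
have : close (Ordinal lt4) w by rewrite close_sym; apply: hw => /=; lia.
by rewrite close_le /=; lia.
Qed.

End IsolatedVertex.

End CirculantComplex.

Local Close Scope quotient_scope.
Local Close Scope ring_scope.

Theorem theorem3p6 (k : fieldType) (n d : nat)
    (hd : 1 <= d) (hn : 2 * d + 2 <= n) :
  graph_S2 k (circulant n [pred a | d + 1 <= a <= n./2])
    <-> 3 * d < n \/ n = 2 * d + 2.
Proof.
split=> [S2|[n_gt|n_eq]].
- have [n_le|] := leqP n (3 * d); last by left.
  right; apply/eqP; rewrite eqn_leq hn andbT leqNgt; apply/negP => n_gt.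
  have n_ge3 : 2 * d + 3 <= n by lia.
  have [F [u1 [u2 [v [[u1F u2F u12 vF] [uD vD iso]]]]]] :=
    isolated_vertex hd hn n_ge3 n_le.
  exact: not_S2_of_isolated_vertex u1F u2F u12 vF uD vD iso S2.
- by apply: (@S2_of_connected_links _ _ _ d.+1);
    [exact: arc_pure | exact: arc_connected].
- by apply: (@S2_of_connected_links _ _ _ d.+1);
    [exact: cross_pure | exact: cross_connected].
Qed.
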